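(* Let $M\ge1$ be an integer and let $X_{iso}:=\{x\in(0,\infty):\mathcal{U}(x)\text{ contains isolated points}\}$. The set $X_{iso}$ is dense in $[0,1]$. If $M=1$, the set $X_{iso}$ is dense in $(0,\infty)$.
   Context: For $q\in(1,M+1]$ and $x\ge0$, a $q$-expansion of $x$ is a sequence $(d_i)_{i\ge1}\in\{0,1,\ldots,M\}^{\mathbb{N}}$ with $x=\sum_{i\ge1}d_iq^{-i}$. $\mathcal{U}(x)$ is the set of $q\in(1,M+1]$ such that $x$ has exactly one $q$-expansion. An isolated point of $\mathcal{U}(x)$ is a point $p\in\mathcal{U}(x)$ with $\mathcal{U}(x)\cap(p-\varepsilon,p+\varepsilon)=\{p\}$ for some $\varepsilon>0$. ''Dense in $[0,1]$'' means that every point of $[0,1]$ is a limit of points of $X_{iso}$, i.e. lies in its closure. *)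

(* Defs.v *)
From HB Require Import structures.
From mathcomp Require Import all_boot all_order all_algebra.
From mathcomp Require Import all_classical all_reals all_analysis.

Set Implicit Arguments.
Unset Strict Implicit.
Unset Printing Implicit Defensive.

Import Order.TTheory GRing.Theory Num.Theory.
Import numFieldNormedType.Exports.

Local Open Scope classical_set_scope.
Local Open Scope ring_scope.

(* Digit sequences are indexed from 0: [d i] is the digit d_(i+1) of weight
   q ^- (i+1). *)
Definition is_expansion (R : realType) (M : nat) (q x : R)
    (d : nat -> 'I_M.+1) : Prop :=
  [series (d i)%:R / q ^+ i.+1]_i @ \oo --> x.

Definition univoque_bases (R : realType) (M : nat) (x : R) : set R :=
  [set q | 1 < q <= M.+1%:R /\ exists! d : nat -> 'I_M.+1, is_expansion q x d].

Definition Xiso (R : realType) (M : nat) : set R :=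
  [set x | 0 < x /\ isolated (univoque_bases M x) !=set0].

Arguments Xiso R M : clear implicits.

(* Main.v *)
Require Import Defs.
From mathcomp Require Import all_boot all_order all_algebra.
From mathcomp Require Import all_classical all_reals all_analysis.
From mathcomp Require Import ring lra zify.
Import Order.TTheory GRing.Theory Num.Theory.
Import numFieldNormedType.Exports.
Local Open Scope classical_set_scope.
Local Open Scope ring_scope.

(** Let [c = M / (q - 1)]. Let [w] be a finite word with positive last digit,
such that the value of [w] in base [q] is below 1, but exceeds 1 once [w] is
followed by a tail of value [c - 1]. Then the unique [q]-expansions are exactly
the sequences in which every tail following a digit [< M], and the reflection
of every tail following a digit [> 0], is lexicographically smaller than [w].
The condition on [q] is open, and for [q'] near [q] a unique expansion in base
[q'] of the value of [d] in base [q] shares a long prefix with [d]. So [q] is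
isolated in U(x) as soon as [x] is the value of an admissible sequence [d] that
is determined, among admissible ones, by a prefix. If [w = a abar^+], where
[abar] is the reflection of [a] and [^+] increases the last digit, an
occurrence of [a] after a digit [< M] forces the tail [a abar a abar ...], so
every admissible sequence with such an occurrence is determined by a prefix.

For [x] in [0,1], take [a = M^K], which is compatible with an arbitrary prefix
of length at most [K - 2], in particular with one of an expansion of [x].

For [M = 1], the Thue-Morse words [w] of length [2^(n+1)] yield consecutive
intervals of bases. On two consecutive ones the value of the sequence
[1 Phi(1 Phi(...))] ([n+1] times, [Phi : 0 -> 01, 1 -> 10]) is in the closure
of X_iso, and the ranges of these values for successive [n] overlap and
accumulate only at 1. Two more sequences, 1^oo and 11(10)^oo, cover the rest
of (1, oo). *)

(** * Digit sequences, reflection and the finite lexicographic condition *)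

Section Digits.
Context {M : nat}.
Implicit Types (d e w : nat -> 'I_M.+1) (m n k : nat).

Definition dshift k d : nat -> 'I_M.+1 := fun i => d (k + i)%N.
Definition refl d : nat -> 'I_M.+1 := fun i => rev_ord (d i).
Definition prefix_lt m d w :=
  exists2 j, (j < m)%N & (forall i, (i < j)%N -> d i = w i) /\ (d j < w j)%N.
(** The classical criterion for unique expansions compares tails with the quasi-greedy expansion of
    1. Here the first [m] digits of [w] take its place, so that one condition serves an open set of
    bases. *)
Definition admissible m w d := forall k,
  ((d k < M)%N -> prefix_lt m (dshift k.+1 d) w) /\
  ((0 < d k)%N -> prefix_lt m (refl (dshift k.+1 d)) w).

Lemma refl_val d i : refl d i = (M - d i)%N :> nat.
Proof. by rewrite /refl /= subSS. Qed.

Lemma digit_le d i : (d i <= M)%N.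
Proof. by rewrite -ltnS. Qed.

Lemma reflK d : refl (refl d) = d.
Proof. by apply/funext => i; rewrite /refl rev_ordK. Qed.

Lemma dshift_refl k d : dshift k (refl d) = refl (dshift k d).
Proof. by []. Qed.

Lemma dshiftD k n d : dshift k (dshift n d) = dshift (n + k) d.
Proof. by apply/funext => i; rewrite /dshift addnA. Qed.

Lemma dshift0 d : dshift 0 d = d.
Proof. by []. Qed.

Lemma admissible_refl m w d : admissible m w d -> admissible m w (refl d).
Proof.
move=> ad k; have [h1 h2] := ad k; rewrite dshift_refl reflK refl_val.
by have := digit_le d k; split => h; [apply: h2|apply: h1]; lia.
Qed.

Lemma prefix_lt_total m d w :
  [\/ prefix_lt m d w, prefix_lt m w d | forall i, (i < m)%N -> d i = w i].
Proof.
elim: m => [|m [[j jm h]|[j jm h]|h]]; first by constructor 3.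
- by constructor 1; exists j => //; lia.
- by constructor 2; exists j => //; lia.
have [e|/eqP ne] := eqVneq (d m) (w m).
  constructor 3 => i; rewrite ltnS leq_eqVlt => /orP[/eqP->//|]; exact: h.
have /orP[lt|lt] : ((d m < w m) || (w m < d m))%N.
  by rewrite -neq_ltn; apply/eqP => /val_inj.
- by constructor 1; exists m => //; split.
- by constructor 2; exists m => //; split=> // i im; rewrite h.
Qed.

End Digits.

(** * Values of digit sequences in a base *)

Section Expansions.
Context {R : realType} {M : nat}.
Implicit Types (d e w : nat -> 'I_M.+1) (m n k : nat) (q x y : R).

Lemma geometric_lt (r B eps : R) : 0 <= r < 1 -> 0 < eps ->
  \forall n \near \oo, B * r ^+ n < eps.
Proof.
move=> /andP[r0 r1] e0.
have h : (fun n => B * r ^+ n) @ \oo --> B * 0.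
  by apply: cvgMl_tmp; apply: cvg_expr; rewrite ger0_norm.
rewrite mulr0 in h; have /cvgr_lt := h; exact.
Qed.

Lemma geometric_le0 (r B z : R) : 0 <= r < 1 ->
  (forall n, z <= B * r ^+ n) -> z <= 0.
Proof.
move=> r01 h; rewrite leNgt; apply/negP => z0.
have [n _ /(_ n)] := geometric_lt r B z r01 z0.
by rewrite /= leqnn => /(_ isT); rewrite ltNge h.
Qed.

Lemma inv_in01 q : 1 < q -> 0 <= q^-1 < 1.
Proof.
move=> q1; have q0 : 0 < q by lra.
by rewrite invr_ge0 (ltW q0) /= invf_lt1.
Qed.

Definition psum q d n : R := \sum_(i < n) (d i)%:R / q ^+ i.+1.
Definition ev q d : R := limn (psum q d).
(** The value of the constant sequence [M^oo], called [c] above. *)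
Definition vmax q : R := M%:R / (q - 1).

Lemma psumS q d n : psum q d n.+1 = psum q d n + (d n)%:R / q ^+ n.+1.
Proof. by rewrite /psum big_ord_recr. Qed.

Lemma psum0 q d : psum q d 0 = 0.
Proof. by rewrite /psum big_ord0. Qed.

Lemma eq_psum q d e n :
  (forall i, (i < n)%N -> d i = e i) -> psum q d n = psum q e n.
Proof. by move=> h; apply: eq_bigr => i _; rewrite h. Qed.

Lemma psum_ge0 q d n : 0 < q -> 0 <= psum q d n.
Proof.
by move=> q0; apply: sumr_ge0 => i _; rewrite divr_ge0 // exprn_ge0 // ltW.
Qed.

Lemma vmaxE q : 1 < q -> q * vmax q = M%:R + vmax q.
Proof. by move=> q1; rewrite /vmax; field; apply: lt0r_neq0; lra. Qed.

Lemma vmax_ge0 q : 1 < q -> 0 <= vmax q.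
Proof. by move=> q1; rewrite /vmax divr_ge0 //; lra. Qed.

Lemma vmax_ge1 q : 1 < q <= M.+1%:R -> 1 <= vmax q.
Proof.
rewrite -natr1 => /andP[q1 q2]; rewrite /vmax ler_pdivlMr; lra.
Qed.

Lemma psumD q d n k : 0 < q ->
  psum q d (n + k) = psum q d n + psum q (dshift n d) k / q ^+ n.
Proof.
move=> q0; elim: k => [|k IH]; first by rewrite addn0 psum0 mul0r addr0.
rewrite addnS !psumS IH -addnS exprD /dshift mulrDl -!addrA; congr (_ + (_ + _)).
by field; rewrite !expf_neq0 // gt_eqF.
Qed.

Lemma psum_le_vmax q d n : 1 < q -> psum q d n <= vmax q * (1 - q^-1 ^+ n).
Proof.
move=> q1; elim: n => [|n IH]; first by rewrite psum0 expr0 subrr mulr0.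
have q0 : 0 < q by lra.
have qn : 0 < q ^+ n.+1 by rewrite exprn_gt0.
rewrite psumS.
have h : (d n)%:R / q ^+ n.+1 <= M%:R / q ^+ n.+1 :> R.
  by rewrite ler_pM2r ?invr_gt0 // ler_nat digit_le.
have -> : vmax q * (1 - q^-1 ^+ n.+1) =
    vmax q * (1 - q^-1 ^+ n) + M%:R / q ^+ n.+1.
  have -> : M%:R = q * vmax q - vmax q by rewrite vmaxE //; ring.
  by rewrite !exprVn !exprS; field; rewrite expf_neq0 gt_eqF.
exact: lerD.
Qed.

Lemma psum_nondecreasing q d : 0 < q -> nondecreasing_seq (psum q d).
Proof.
move=> q0; apply/nondecreasing_seqP => n.
by rewrite psumS lerDl divr_ge0 // exprn_ge0 // ltW.
Qed.

Lemma psum_le q d n : 1 < q -> psum q d n <= vmax q.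
Proof.
move=> q1; apply: (le_trans (psum_le_vmax _ _ _ q1)).
have := vmax_ge0 q q1; have : 0 <= q^-1 ^+ n.
  by rewrite exprn_ge0 // invr_ge0; lra.
nra.
Qed.

Lemma psum_cvg q d : 1 < q -> cvgn (psum q d).
Proof.
move=> q1; apply: nondecreasing_is_cvgn.
  by apply: psum_nondecreasing; lra.
by exists (vmax q) => _ [n _ <-]; exact: psum_le.
Qed.

Lemma seriesE q d : [series (d i)%:R / q ^+ i.+1]_i = psum q d.
Proof. by apply/funext => n; rewrite /series /= big_mkord. Qed.

Lemma is_expansionP q d x : 1 < q -> is_expansion q x d <-> ev q d = x.
Proof.
move=> q1; rewrite /is_expansion seriesE; split => [h|<-].
  exact/cvg_lim.
exact: psum_cvg.
Qed.

Lemma ev_ge0 q d : 1 < q -> 0 <= ev q d.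
Proof.
move=> q1; apply: limr_ge; first exact: psum_cvg.
by apply: nearW => n; apply: psum_ge0; lra.
Qed.

Lemma ev_le q d : 1 < q -> ev q d <= vmax q.
Proof.
move=> q1; apply: limr_le; first exact: psum_cvg.
by apply: nearW => n; exact: psum_le.
Qed.

Lemma evD q d n : 1 < q -> ev q d = psum q d n + ev q (dshift n d) / q ^+ n.
Proof.
move=> q1; rewrite /ev; apply/cvg_lim => //.
rewrite -(cvg_shiftn n).
have -> : (fun m => psum q d (m + n)) =
    (fun m => psum q d n + psum q (dshift n d) m / q ^+ n).
  by apply/funext => m; rewrite addnC psumD //; lra.
apply: cvgD; first exact: cvg_cst.
by apply: cvgMr_tmp; exact: psum_cvg.
Qed.

Lemma ev_rec q d : 1 < q -> q * ev q d = (d 0%N)%:R + ev q (dshift 1 d).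
Proof.
move=> q1; rewrite (evD _ _ 1) // psumS psum0 expr1; field.
by apply: lt0r_neq0; lra.
Qed.

(** Both [x] and [ev q d] lie within a bounded multiple of [q^-n] of [psum q d n]. Values can thus
    be identified by a recursion for remainders. *)
Lemma ev_eq_of_remainders q d x (r : nat -> R) B : 1 < q ->
  (forall n, x = psum q d n + r n / q ^+ n) -> (forall n, `|r n| <= B) ->
  ev q d = x.
Proof.
move=> q1 h rB; have q0 : 0 < q by lra.
apply/eqP; rewrite -subr_eq0 -normr_le0; apply/eqP.
have bnd : `|ev q d - x| <= 0.
  apply: (geometric_le0 q^-1 (vmax q + B)); first exact: inv_in01.
  move=> n; rewrite (evD _ _ n q1) [x in _ - x](h n).
  have -> : psum q d n + ev q (dshift n d) / q ^+ n - (psum q d n + r n / q ^+ n)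
    = (ev q (dshift n d) - r n) / q ^+ n by ring.
  rewrite normrM exprVn [ `|_^-1|]ger0_norm ?invr_ge0 ?exprn_ge0 ?(ltW q0) //.
  rewrite ler_pM2r ?invr_gt0 ?exprn_gt0 //.
  apply: (le_trans (ler_normB _ _)); apply: lerD => //.
  by rewrite ger0_norm ?ev_le ?ev_ge0.
by apply/eqP; rewrite bnd.
Qed.

Lemma ev_refl q d : 1 < q -> ev q (refl d) = vmax q - ev q d.
Proof.
move=> q1; have q0 : 0 < q by lra.
apply: (ev_eq_of_remainders _ _ _ (fun n => vmax q - ev q (dshift n d)) (vmax q)) => //.
  elim=> [|n IH]; first by rewrite psum0 add0r expr0 divr1 dshift0.
  rewrite psumS {1}IH -addrA; congr (_ + _).
  have : q * ev q (dshift n d) = (d n)%:R + ev q (dshift n.+1 d).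
    by rewrite ev_rec // dshiftD addn1 /dshift addn0.
  have -> : (refl d n)%:R = M%:R - (d n)%:R :> R.
    by rewrite refl_val natrB ?digit_le.
  rewrite exprS => H; have c := vmaxE q q1.
  have e1 : ev q (dshift n.+1 d) = q * ev q (dshift n d) - (d n)%:R by lra.
  have e2 : M%:R = q * vmax q - vmax q by lra.
  rewrite e1 e2; field; by rewrite expf_neq0 gt_eqF.
move=> n; have := ev_ge0 q (dshift n d) q1; have := ev_le q (dshift n d) q1.
move=> *; rewrite ger0_norm; lra.
Qed.

(** Greedy algorithm. The remainder stays in [[0, vmax]]: a digit capped at [M] leaves at most
    [q * vmax - M = vmax], an uncapped one leaves less than 1, and [1 <= vmax] because
    [q <= M + 1]. *)
Lemma expansion_exists q y : 1 < q <= M.+1%:R -> 0 <= y <= vmax q ->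
  exists d, ev q d = y.
Proof.
move=> q1M y0; have /andP[q1 qM] := q1M; have c1 := vmax_ge1 q q1M.
have cE := vmaxE q q1.
pose dig (r : R) : 'I_M.+1 := inord (minn M (Num.truncn (q * r))).
pose r := fix r n := if n is n'.+1 then q * r n' - (dig (r n'))%:R else y.
have digE z : dig z = minn M (Num.truncn (q * z)) :> nat.
  by rewrite /dig inordK // ltnS geq_minl.
have rB n : 0 <= r n <= vmax q.
  elim: n => [|n /andP[r0 rc]] //=.
  have qr0 : 0 <= q * r n by apply: mulr_ge0 => //; lra.
  have /andP[t1 t2] := truncn_itv qr0.
  rewrite digE; case: leqP => [h|h].
    have : M%:R <= (Num.truncn (q * r n))%:R :> R by rewrite ler_nat.
    have : q * r n <= q * vmax q by rewrite ler_pM2l //; lra.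
    by lra.
  by rewrite -natr1 in t2; lra.
exists (fun n => dig (r n)).
apply: (ev_eq_of_remainders _ _ _ r (vmax q)) => //; last first.
  by move=> n; have /andP[a b] := rB n; rewrite ger0_norm.
elim=> [|n IH]; first by rewrite psum0 add0r expr0 divr1.
rewrite psumS {1}IH -addrA; congr (_ + _) => /=.
rewrite exprS; field; rewrite expf_neq0 gt_eqF //; lra.
Qed.

Lemma ev_sub_psum q d n : 1 < q ->
  q ^+ n.+1 * (ev q d - psum q d n) = (d n)%:R + ev q (dshift n.+1 d).
Proof.
move=> q1; rewrite (evD _ _ n.+1 q1) psumS.
by field; rewrite expf_neq0 // gt_eqF //; lra.
Qed.

End Expansions.
Arguments vmax {R} M q.

(** * Unique expansions: tail bounds and the lexicographic condition *)

Section Univoque.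
Context {R : realType} {M : nat}.
Implicit Types (d e w : nat -> 'I_M.+1) (m n k : nat) (q x y : R).

Definition unique_at q d := forall e, ev q e = ev q d -> e = d.

(** A digit below [M] could be raised if its tail could give up 1, and a positive digit lowered if
    its tail could absorb 1; the bounds exclude both. *)
Definition tail_bounded q d := forall k,
  ((d k < M)%N -> ev q (dshift k.+1 d) < 1) /\
  ((0 < d k)%N -> vmax M q - ev q (dshift k.+1 d) < 1).

Lemma tail_bounded_refl q d : 1 < q -> tail_bounded q d ->
  tail_bounded q (refl d).
Proof.
move=> q1 h k; have [h1 h2] := h k.
rewrite dshift_refl ev_refl // refl_val; have := digit_le d k.
split => hk; last by have := h1 ltac:(lia); lra.
by apply: h2; lia.
Qed.

Lemma ev_eq_step q q' d e n : 1 < q -> (forall i, (i < n)%N -> e i = d i) ->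
  ev q e = ev q d ->
  (e n)%:R + ev q (dshift n.+1 e) = (d n)%:R + ev q (dshift n.+1 d).
Proof.
by move=> q1 h H; rewrite -!ev_sub_psum // (eq_psum q e d n h) H.
Qed.

Lemma digit_natr_lt d e n : (d n < e n)%N -> (d n)%:R + 1 <= (e n)%:R :> R.
Proof. by rewrite natr1 ler_nat. Qed.

(** At the first difference, a larger digit of [e] requires a tail of [d] worth at least 1, and a
    smaller one a tail of [e] worth more than [vmax]. *)
Lemma tail_bounded_unique q d : 1 < q -> tail_bounded q d -> unique_at q d.
Proof.
move=> q1 h e He; apply/funext => i; elim/ltn_ind: i => n IH.
have H := ev_eq_step q q d e n q1 IH He; have [h1 h2] := h n.
have e0 := ev_ge0 q (dshift n.+1 e) q1; have e1 := ev_le q (dshift n.+1 e) q1.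
apply: val_inj => /=; apply/eqP; rewrite eqn_leq; apply/andP; split;
  rewrite leqNgt; apply/negP => lt.
  have lt' := digit_natr_lt _ _ _ lt.
  by have dM := h1 (leq_trans lt (digit_le e n)); lra.
have lt' := digit_natr_lt _ _ _ lt.
by have dM := h2 (leq_ltn_trans (leq0n _) lt); lra.
Qed.

Lemma unique_refl q d : 1 < q -> unique_at q d -> unique_at q (refl d).
Proof.
move=> q1 u e; rewrite ev_refl // => H.
by rewrite -[e]reflK (u (refl e)) // ev_refl // H; ring.
Qed.

(** Were the tail worth at least 1, raising [d k] by one and continuing with an expansion of the
    tail value minus 1 would give a second expansion. *)
Lemma unique_tail_lt1 q d k : 1 < q <= M.+1%:R -> unique_at q d ->
  (d k < M)%N -> ev q (dshift k.+1 d) < 1.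
Proof.
move=> q1M u dk; have /andP[q1 _] := q1M; rewrite ltNge; apply/negP => h.
have [|e He] := expansion_exists q (ev q (dshift k.+1 d) - 1) q1M.
  by have := ev_le q (dshift k.+1 d) q1; lra.
pose d' i := if (i < k)%N then d i else
  if i == k then inord (d k).+1 else e (i - k.+1)%N.
have dk' : d' k = (d k).+1 :> nat.
  by rewrite /d' ltnn eqxx inordK.
have sk : dshift k.+1 d' = e.
  apply/funext => i; rewrite /dshift /d'.
  by do 2 (case: ifP => [?|_]; first lia); congr e; lia.
suff /u E : ev q d' = ev q d by have := dk'; rewrite E; lia.
rewrite (evD q d' k.+1 q1) (evD q d k.+1 q1) sk He !psumS dk'.
rewrite (eq_psum q d' d k) => [|i ik]; last by rewrite /d' ik.
rewrite -natr1; ring.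
Qed.

Lemma unique_tail_bounded q d : 1 < q <= M.+1%:R -> unique_at q d ->
  tail_bounded q d.
Proof.
move=> q1M u k; split; first exact: unique_tail_lt1.
move=> dk; have /andP[q1 _] := q1M.
have := unique_tail_lt1 q (refl d) k q1M (unique_refl q d q1 u).
rewrite dshift_refl ev_refl // refl_val; apply.
by have := digit_le d k; lia.
Qed.

Lemma le_psum q w m n : 0 < q -> (m <= n)%N -> psum q w m <= psum q w n.
Proof. by move=> q0; apply: psum_nondecreasing. Qed.

(** Let the tail first fall below [w] at place [j]. The digit there is below [M], so the tail after
    it is of the same kind, and the excess over 1 of the first tail is below that of the second
    divided by [q^(j+1)]. *)
Lemma admissible_tail_lt1 q m w d k : 1 < q -> psum q w m < 1 ->
  admissible m w d -> (d k < M)%N -> ev q (dshift k.+1 d) < 1.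
Proof.
move=> q1 P1 ad dk; have q0 : 0 < q by lra.
have step l : (d l < M)%N -> exists2 j, (d (l.+1 + j)%N < M)%N &
    ev q (dshift l.+1 d) <=
      psum q w m + (ev q (dshift (l.+1 + j).+1 d) - 1) / q ^+ j.+1.
  move=> /(proj1 (ad l))[j jm [agree lt]]; exists j.
    by apply: leq_trans lt (digit_le w j).
  rewrite (evD q _ j.+1 q1) dshiftD addnS psumS.
  rewrite (eq_psum q _ w j agree).
  have := le_psum q w j.+1 m q0 jm; rewrite psumS.
  have qj : 0 < (q ^+ j.+1)^-1 by rewrite invr_gt0 exprn_gt0.
  have := digit_natr_lt _ _ _ lt; nra.
(* Iterating [n] times shrinks the excess, at first bounded by [vmax], by the factor [q^-n]. *)
have bnd n : forall l, (d l < M)%N ->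
    ev q (dshift l.+1 d) - 1 <= vmax M q * q^-1 ^+ n.
  elim: n => [|n IH] l dl.
    by rewrite expr0; have := ev_le q (dshift l.+1 d) q1; lra.
  have [j dj h] := step l dl; have := IH _ dj.
  set z := ev q (dshift (l.+1 + j).+1 d) in h *; move=> hz.
  have c0 := @vmax_ge0 _ M q q1; have /andP[i0 i1] := inv_in01 q q1.
  have B0 : 0 <= vmax M q * q^-1 ^+ n.
    by rewrite mulr_ge0 // exprn_ge0.
  have : (z - 1) / q ^+ j.+1 <= vmax M q * q^-1 ^+ n * q^-1.
    rewrite -exprVn exprS.
    have j0 : 0 <= q^-1 ^+ j by rewrite exprn_ge0.
    have j1 : q^-1 ^+ j <= 1 by rewrite exprn_ile1 // ltW.
    apply: (@le_trans _ _ (vmax M q * q^-1 ^+ n * (q^-1 * q^-1 ^+ j))).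
      by apply: ler_wpM2r => //; rewrite mulr_ge0.
    apply: ler_wpM2l => //; nra.
  by move=> hzj; rewrite [q^-1 ^+ n.+1]exprSr mulrA; lra.
(* The limit only gives a value of at most 1; one more comparison uses [psum q w m < 1] to make it
   strict. *)
have [j dj h] := step k dk.
have z1 : ev q (dshift (k.+1 + j).+1 d) - 1 <= 0.
  by apply: (geometric_le0 q^-1 (vmax M q)) => [|n]; [exact: inv_in01|exact: bnd].
apply: (le_lt_trans h); apply: le_lt_trans P1.
by rewrite gerDl mulr_le0_ge0 // invr_ge0 exprn_ge0 // ltW.
Qed.

Lemma admissible_tail_bounded q m w d : 1 < q -> psum q w m < 1 ->
  admissible m w d -> tail_bounded q d.
Proof.
move=> q1 P1 ad k; split; first by move=> dk; exact: (admissible_tail_lt1 q m w d k).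
move=> dk.
have := admissible_tail_lt1 q m w (refl d) k q1 P1 (admissible_refl _ _ _ ad).
rewrite dshift_refl ev_refl // refl_val; apply.
by have := digit_le d k; lia.
Qed.

(* A tail following a digit [< M] has value [< 1], and a tail following a
   positive digit has value [> c - 1]; the latter makes a tail that is not
   lexicographically below [w] too large. *)
Lemma tail_bounded_prefix_lt q m w d k : 1 < q ->
  1 < psum q w m + (vmax M q - 1) / q ^+ m -> (0 < w m.-1)%N ->
  (0 < m)%N -> tail_bounded q d -> (d k < M)%N ->
  prefix_lt m (dshift k.+1 d) w.
Proof.
move=> q1 P1 w0 m0 tb dk; have q0 : 0 < q by lra.
have qV n : 0 < (q ^+ n)^-1 by rewrite invr_gt0 exprn_gt0.
have V1 := proj1 (tb k) dk.
case: (prefix_lt_total m (dshift k.+1 d) w) => // [[j jm [agree lt]]|agree].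
  have d0 : (0 < d (k.+1 + j)%N)%N by apply: leq_ltn_trans lt.
  have := proj2 (tb (k.+1 + j)%N) d0 => hj.
  suff : psum q w m + vmax M q / q ^+ m <= ev q (dshift k.+1 d).
    have := qV m; nra.
  rewrite (evD q _ j.+1 q1) dshiftD addnS psumS.
  rewrite (eq_psum q _ w j) => [|i ij]; last by rewrite agree.
  have := digit_natr_lt _ _ _ lt.
  have : psum q w m + vmax M q / q ^+ m <=
      psum q w j.+1 + vmax M q / q ^+ j.+1.
    rewrite -(subnKC jm) psumD // -addrA lerD2l exprD invfM.
    have := @psum_le_vmax R M q (dshift j.+1 w) (m - j.+1) q1.
    by rewrite exprVn; have := qV j.+1; nra.
  rewrite psumS; have := qV j.+1; nra.
have E : d (k.+1 + m.-1)%N = w m.-1 by apply: agree; rewrite prednK.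
have := proj2 (tb (k.+1 + m.-1)%N); rewrite E => /(_ w0).
rewrite -addnS prednK // => hm.
move: V1; rewrite (evD q _ m q1) dshiftD (eq_psum q _ w m agree).
rewrite addSn; have := qV m; nra.
Qed.

Lemma tail_bounded_admissible q m w d : 1 < q ->
  1 < psum q w m + (vmax M q - 1) / q ^+ m -> (0 < w m.-1)%N ->
  (0 < m)%N -> tail_bounded q d -> admissible m w d.
Proof.
move=> q1 P1 w0 m0 tb k; split; first by move=> dk; exact: (tail_bounded_prefix_lt q).
move=> dk; have tb' := tail_bounded_refl q d q1 tb.
rewrite -dshift_refl; apply: (tail_bounded_prefix_lt q) => //.
by rewrite refl_val; have := digit_le d k; lia.
Qed.

Lemma ev_lt q q' d k : 1 < q -> q < q' -> (0 < d k)%N -> ev q' d < ev q d.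
Proof.
move=> q1 qq' dk; have q0 : 0 < q by lra.
have iV n : (q' ^+ n)^-1 <= (q ^+ n)^-1.
  rewrite lef_pV2 ?posrE ?exprn_gt0 //; last lra.
  by rewrite lerXn2r ?nnegrE; lra.
have le e n : psum q' e n <= psum q e n.
  by apply: ler_sum => i _; apply: ler_wpM2l.
rewrite (evD q d k.+1) // (evD q' d k.+1); last lra.
have le_ev : ev q' (dshift k.+1 d) <= ev q (dshift k.+1 d).
  apply: ler_lim; [by apply: psum_cvg; lra|exact: psum_cvg|].
  exact: nearW.
apply: ltr_leD; last first.
  apply: ler_pM => //; first by apply: ev_ge0; lra.
  by rewrite invr_ge0 exprn_ge0 //; lra.
rewrite !psumS; apply: ler_ltD => //; rewrite ltr_pM2l ?ltr0n //.
rewrite ltf_pV2 ?posrE ?exprn_gt0 //; last lra.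
by rewrite ltrXn2r ?nnegrE //; lra.
Qed.

Lemma vmax_continuous q : 1 < q -> {for q, continuous (@vmax R M)}.
Proof.
move=> q1; rewrite /vmax; apply: cvgMl_tmp; apply: cvgV; first by lra.
by apply: cvgB; [exact: cvg_id|exact: cvg_cst].
Qed.

Lemma psum_continuous q d n : 0 < q -> {for q, continuous (fun t => psum t d n)}.
Proof.
move=> q0; elim: n => [|n IH].
  have -> : (fun t : R => psum t d 0) = (fun=> 0 : R) by apply/funext=> t; rewrite psum0.
  exact: cvg_cst.
have -> : (fun t : R => psum t d n.+1) =
  (fun t => psum t d n + (d n)%:R / t ^+ n.+1) by apply/funext=> t; rewrite psumS.
apply: cvgD => //; apply: cvgMl_tmp; apply: cvgV; last exact: exprn_continuous.
by rewrite expf_neq0 // gt_eqF.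
Qed.
End Univoque.

(** * Isolation of a base *)

Section IsolatedBases.
Context {R : realType} {M : nat}.
Implicit Types (d e w : nat -> 'I_M.+1) (m n k : nat) (q x y : R).

(** A polynomial in [q] that continues the tail value of [d] to bases where [d] does not represent
    [x]. *)
Fixpoint remainder x d n q : R :=
  if n is n'.+1 then q * remainder x d n' q - (d n')%:R else x.

Lemma remainder_ev q d n : 1 < q -> remainder (ev q d) d n q = ev q (dshift n d).
Proof.
move=> q1; elim: n => [|n IH] //=.
by rewrite IH ev_rec // dshiftD addn1 /dshift addn0; ring.
Qed.

Lemma remainder_continuous x d n : continuous (remainder x d n).
Proof.
elim: n => [|n IH] q /=; first exact: cvg_cst.
by apply: cvgB; [apply: cvgM; [exact: cvg_id|exact: IH]|exact: cvg_cst].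
Qed.

Lemma near_gt1 q : 1 < q -> \forall q' \near q, 1 < q'.
Proof. by move=> q1; apply: lt_nbhsr. Qed.

(** Induction on [N]: by continuity the strict bounds on the tail after digit [N] carry over to
    [remainder] in nearby bases, where they force digit [N] of [e] as in [tail_bounded_unique]. *)
Lemma near_expansion_prefix q d N : 1 < q -> tail_bounded q d ->
  \forall q' \near q, forall e, ev q' e = ev q d ->
    (forall i, (i < N)%N -> e i = d i) /\
    ev q' (dshift N e) = remainder (ev q d) d N q'.
Proof.
move=> q1 tb; set x := ev q d; elim: N => [|N IH].
  by near=> q' => e ->; split.
have X1 := remainder_ev q d N.+1 q1; have [t1 t2] := tb N.
have c1 : {for q, continuous (remainder x d N.+1)} by exact: remainder_continuous.
have near1 : \forall q' \near q, (d N < M)%N -> remainder x d N.+1 q' < 1.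
  have [dN|dN] := boolP (d N < M)%N; last by near=> q'.
  have lt1 : remainder x d N.+1 q < 1 by rewrite X1; exact: t1.
  by near=> q' => _; near: q'; exact: (cvgr_lt _ c1).
have near2 : \forall q' \near q, (0 < d N)%N ->
    vmax M q' - remainder x d N.+1 q' < 1.
  have [dN|dN] := boolP (0 < d N)%N; last by near=> q'.
  have lt1 : vmax M q - remainder x d N.+1 q < 1 by rewrite X1; exact: t2.
  have c2 : {for q, continuous (fun t => vmax M t - remainder x d N.+1 t)}.
    by apply: cvgB; [exact: vmax_continuous|exact: c1].
  by near=> q' => _; near: q'; exact: (cvgr_lt _ c2).
have near0 := near_gt1 q q1.
near=> q' => e He.
have q'1 : 1 < q' by near: q'.
have n1 : (d N < M)%N -> remainder x d N.+1 q' < 1 by near: q'.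
have n2 : (0 < d N)%N -> vmax M q' - remainder x d N.+1 q' < 1 by near: q'.
have n3 : forall e, ev q' e = x -> (forall i, (i < N)%N -> e i = d i) /\
    ev q' (dshift N e) = remainder x d N q' by near: q'.
have [agree rem] := n3 e He.
have H : (e N)%:R + ev q' (dshift N.+1 e) = (d N)%:R + remainder x d N.+1 q'.
  rewrite /= -rem ev_rec // dshiftD addn1 /dshift addn0; ring.
have e0 := ev_ge0 q' (dshift N.+1 e) q'1; have e1 := ev_le q' (dshift N.+1 e) q'1.
have E : e N = d N.
  apply: val_inj => /=; apply/eqP; rewrite eqn_leq; apply/andP; split;
    rewrite leqNgt; apply/negP => lt.
    have lt' : (d N)%:R + 1 <= (e N)%:R :> R := digit_natr_lt _ _ _ lt.
    by have := n1 (leq_trans lt (digit_le e N)); lra.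
  have lt' : (e N)%:R + 1 <= (d N)%:R :> R := digit_natr_lt _ _ _ lt.
  by have := n2 (leq_ltn_trans (leq0n _) lt); lra.
split; last by move: H; rewrite E; lra.
by move=> i; rewrite ltnS leq_eqVlt => /orP[/eqP->|/agree].
Unshelve. all: by end_near. Qed.

(* Equivalently, [1] is the value of [w] followed by a tail of value in
   ]0, c - 1[. *)
Definition word_base m w q :=
  psum q w m < 1 /\ 1 < psum q w m + (vmax M q - 1) / q ^+ m.

(** A unique expansion [e] of the same value in a nearby base [q'] is admissible and shares [N]
    digits with [d], so [e = d]. *)
Theorem isolated_base q m w d N : 1 < q < M.+1%:R ->
  word_base m w q -> (0 < m)%N -> (0 < w m.-1)%N -> admissible m w d ->
  (exists k, (0 < d k)%N) ->
  (forall e, admissible m w e -> (forall i, (i < N)%N -> e i = d i) -> e = d) ->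
  Xiso R M (ev q d).
Proof.
move=> /andP[q1 qM] [P1 P2] m0 w0 ad [k dk] iso.
have q0 : 0 < q by lra.
have tb := admissible_tail_bounded q m w d q1 P1 ad.
have evlt t : 1 < t -> 0 < ev t d.
  move=> t1; rewrite (evD _ _ k.+1) // psumS.
  have := psum_ge0 t d k ltac:(lra); have := ev_ge0 t (dshift k.+1 d) t1.
  move=> a b; apply: ltr_wpDr; first by rewrite divr_ge0 // exprn_ge0; lra.
  by apply: ltr_wpDl => //; rewrite divr_gt0 ?ltr0n // exprn_gt0; lra.
split; first exact: evlt.
have uq : univoque_bases M (ev q d) q.
  split; first by rewrite q1 ltW.
  exists d; split; first exact/is_expansionP.
  move=> e /is_expansionP => /(_ q1) H.
  by rewrite (tail_bounded_unique q d q1 tb e H).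
exists q; split; first exact/mem_set.
exists [set q' | [/\ 1 < q', 1 < psum q' w m + (vmax M q' - 1) / q' ^+ m &
  forall e, ev q' e = ev q d -> (forall i, (i < N)%N -> e i = d i) /\
    ev q' (dshift N e) = remainder (ev q d) d N q']].
  have cP : {for q, continuous (fun t : R => psum t w m + (vmax M t - 1) / t ^+ m)}.
    apply: cvgD; first exact: psum_continuous.
    apply: cvgM; first by apply: cvgB; [exact: vmax_continuous|exact: cvg_cst].
    apply: cvgV; last exact: exprn_continuous.
    by rewrite expf_neq0 // gt_eqF.
  have n1 := near_gt1 q q1; have n2 := near_expansion_prefix q d N q1 tb.
  have n3 : \forall t \near q, 1 < psum t w m + (vmax M t - 1) / t ^+ m.
    exact: (cvgr_gt _ cP).
  near=> q'; split; [by near: q'|by near: q'|by near: q'].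
apply/seteqP; split => [q' [[q'1 P2' pre] [/andP[_ q'M] [e [eE eU]]]]|_ ->].
  have {}eE : ev q' e = ev q d by exact/(is_expansionP q' e _ q'1).
  have ue : unique_at q' e.
    by move=> f Hf; rewrite (eU f) //; apply/is_expansionP => //; rewrite Hf.
  have tbe := unique_tail_bounded q' e ltac:(rewrite q'1 q'M //) ue.
  have ade := tail_bounded_admissible q' m w e q'1 P2' w0 m0 tbe.
  have ed := iso e ade (proj1 (pre e eE)).
  (* Since [d] has a positive digit, its value strictly decreases with the base, so [q' = q]. *)
  rewrite ed in eE; apply/eqP; rewrite eq_le !leNgt; apply/andP; split.
    by apply/negP => /(ev_lt q q' d k q1) => /(_ dk); rewrite eE ltxx.
  by apply/negP => /(ev_lt q' q d k q'1) => /(_ dk); rewrite eE ltxx.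
split; last exact: uq.
split => //; exact: (nbhs_singleton (near_expansion_prefix q d N q1 tb)).
Unshelve. all: by end_near. Qed.

End IsolatedBases.

(** * Tails forced by a doubled word *)

Section ForcedTails.
Context {M : nat}.
Implicit Types (d e w : nat -> 'I_M.+1) (k L : nat).

(* [w] is the word [a abar^+] where [a] has length [L] and positive last digit,
   [abar] is its reflection and [^+] increases the last digit by one. *)
Definition doubled L w := [/\ (0 < L)%N, (0 < w L.-1)%N,
  forall i, (i < L.-1)%N -> (w (L + i) + w i = M)%N &
  (w (L + L.-1) + w L.-1 = M.+1)%N].

Lemma doubled_last_gt0 L w : doubled L w -> (0 < w (L + L).-1)%N.
Proof.
move=> [L0 _ _ last]; have -> : ((L + L).-1 = L + L.-1)%N by lia.
by have := digit_le w L.-1; lia.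
Qed.

(** After [a], lying below [w = a abar^+] makes the next block at most [abar]. The last digit of [a]
    is positive, so the reflected next block is at most [a], and the block is at least [abar]. *)
Lemma doubled_forces_block L w d k : doubled L w -> admissible (L + L) w d ->
  (d k < M)%N -> (forall i, (i < L)%N -> d (k.+1 + i)%N = w i) ->
  forall i, (i < L)%N -> d (k.+1 + L + i)%N = rev_ord (w i).
Proof.
move=> [L0 wL wrefl wlast] ad dk blk.
have [j jL [agree lt]] := proj1 (ad k) dk.
have Lj : (L <= j)%N.
  by rewrite leqNgt; apply/negP => jl; move: lt; rewrite /dshift blk // ltnn.
have dl : (0 < d (k.+1 + L.-1)%N)%N by rewrite blk ?prednK.
have kL : (k.+1 + L.-1).+1 = (k.+1 + L)%N by rewrite -addnS prednK.
have [j' j'L [agree' lt']] := proj2 (ad (k.+1 + L.-1)%N) dl.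
rewrite kL in agree' lt'.
have val' i : refl (dshift (k.+1 + L) d) i = (M - d (k.+1 + L + i)%N)%N :> nat.
  by rewrite refl_val.
have D i : (d (k.+1 + L + i)%N <= M)%N by exact: digit_le.
have [Lj'|j'l] := leqP L j'.
  move=> i iL; apply: val_inj.
  have := congr1 (@nat_of_ord _) (agree' i ltac:(lia)).
  by rewrite val' /= subSS => <-; rewrite subKn.
(* Otherwise the next block exceeds [abar] at its first difference [j'] and is below [abar^+] at its
   first difference [j - L]; each order of these two places is contradictory. *)
exfalso.
have agree2 i : (i < j - L)%N -> d (k.+1 + L + i)%N = w (L + i)%N.
  by move=> ij; rewrite -agree /dshift ?addnA //; lia.
have lt2 : (d (k.+1 + L + (j - L))%N < w (L + (j - L))%N)%N.
  by move: lt; rewrite /dshift -addnA !subnKC.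
rewrite val' in lt'.
have W i : (w i <= M)%N by exact: digit_le.
have [c|c|c] := ltngtP j' (j - L)%N.
- have := agree2 j' c; have := wrefl j' ltac:(lia).
  by move=> h /(congr1 (@nat_of_ord _)) /= h2; have := W j'; lia.
- have := congr1 (@nat_of_ord _) (agree' (j - L)%N c); rewrite val'.
  have := wrefl (j - L)%N ltac:(lia); have := D (j - L)%N; lia.
- rewrite c in lt'.
  have [e|ne] := eqVneq (j - L)%N L.-1.
    by move: wlast lt2 lt'; rewrite e; have := W L.-1; have := D L.-1; lia.
  have := wrefl (j - L)%N ltac:(lia); have := W (j - L)%N.
  have := D (j - L)%N; lia.
Qed.

(** In the reflected sequence the forced block reads [a] and again follows a digit below [M], so the
    argument repeats; hence the induction runs over all [d] and [k]. *)
Lemma doubled_forces_tail L w d k : doubled L w -> admissible (L + L) w d ->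
  (d k < M)%N -> (forall i, (i < L)%N -> d (k.+1 + i)%N = w i) ->
  forall i, d (k.+1 + L + i)%N = rev_ord (d (k.+1 + i)%N).
Proof.
move=> dw; have [L0 wL _ _] := dw.
suff H n : forall d k, admissible (L + L) w d -> (d k < M)%N ->
    (forall i, (i < L)%N -> d (k.+1 + i)%N = w i) ->
    forall i, (i < n * L)%N -> d (k.+1 + L + i)%N = rev_ord (d (k.+1 + i)%N).
  by move=> ad dk blk i; apply: (H i.+1) => //; nia.
elim: n => [|n IH] {}d {}k ad dk blk i; first by rewrite mul0n.
have blk2 := doubled_forces_block _ _ _ _ dw ad dk blk.
have [iL _|Li] := ltnP i L; first by rewrite blk2 // blk.
rewrite mulSn => iM.
have kL : (k.+1 + L.-1).+1 = (k.+1 + L)%N by rewrite -addnS prednK.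
have rlt : (refl d (k.+1 + L.-1)%N < M)%N.
  by rewrite refl_val blk ?prednK //; have := digit_le w L.-1; lia.
have := IH (refl d) (k.+1 + L.-1)%N (admissible_refl _ _ _ ad) rlt.
rewrite kL => h; apply: rev_ord_inj.
have {}h := h _ (i - L)%N ltac:(lia).
rewrite -[i in LHS](subnKC Li) -[i in RHS](subnKC Li) !addnA; apply: h => j jL.
by rewrite /refl blk2 // rev_ordK.
Qed.

(** Both sequences reflect their digits every [L] places from the occurrence of [a] on, so the
    prefix through [a] determines them. *)
Lemma doubled_isolated L w d k : doubled L w -> admissible (L + L) w d ->
  (d k < M)%N -> (forall i, (i < L)%N -> d (k.+1 + i)%N = w i) ->
  forall e, admissible (L + L) w e ->
    (forall i, (i < k.+1 + L)%N -> e i = d i) -> e = d.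
Proof.
move=> dw ad dk blk e ae agree; have [L0 _ _ _] := dw.
have td := doubled_forces_tail L w d k dw ad dk blk.
have te := doubled_forces_tail L w e k dw ae.
rewrite agree in te; last lia.
have {}te := te dk; have {}te : forall i, e (k.+1 + L + i)%N = rev_ord (e (k.+1 + i)%N).
  by apply: te => i iL; rewrite agree ?blk //; lia.
apply/funext => i; elim/ltn_ind: i => i IH.
have [lt|ge] := ltnP i (k.+1 + L); first exact: agree.
by rewrite -(subnKC ge) td te IH //; lia.
Qed.

End ForcedTails.

Lemma closure_approx {R : realType} (A : set R) (x : R) :
  (forall eps, 0 < eps -> exists2 y, A y & `|x - y| < eps) -> closure A x.
Proof.
move=> h B /nbhs_ballP[eps /= eps0 sub]; have [y Ay xy] := h eps eps0.
by exists y; split => //; apply: sub.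
Qed.

Lemma ivt_decreasing {R : realType} (f : R -> R) (a b v : R) : a <= b ->
  (forall t, a <= t <= b -> {for t, continuous f}) -> f b <= v <= f a ->
  exists2 t, a <= t <= b & f t = v.
Proof.
move=> ab cf /andP[fb fa].
have [|||t tab ft] := @IVT R f a b v => //.
- by apply: continuous_in_subspaceT => t; rewrite inE /= in_itv /=; exact: cf.
- by rewrite minC ge_min fb /= le_max fa.
- by exists t => //; rewrite in_itv /= in tab.
Qed.

(** * Density in [0,1] *)

Section UnitInterval.
Context {R : realType} {M : nat}.
Implicit Types (K N : nat) (u : nat -> 'I_M.+1) (q x : R).

(** [M^K 0^(K-1) 1], the word [a abar^+] for [a = M^K]. *)
Definition switch_word K : nat -> 'I_M.+1 := fun i =>
  if (i < K)%N then ord_max else if i == (K + K.-1)%N then inord 1 else ord0.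

(** The first [N] digits of [u], then [0 M^K 0^K M^K 0^K ...]. *)
Definition blocks_after N K u : nat -> 'I_M.+1 := fun i =>
  if (i < N)%N then u i else if i == N then ord0 else
  if odd ((i - N.+1) %/ K) then ord0 else ord_max.

Lemma switch_word_doubled K : (0 < M)%N -> (0 < K)%N -> doubled K (switch_word K).
Proof.
move=> M0 K0; rewrite /switch_word; split => //.
- by rewrite prednK // leqnn.
- move=> i iK.
  have -> : (K + i < K)%N = false by lia.
  have -> : (K + i == K + K.-1)%N = false by lia.
  by have -> : (i < K)%N by lia.
- have -> : (K + K.-1 < K)%N = false by lia.
  by rewrite eqxx prednK // leqnn inordK.
Qed.

Lemma psum_ord_max q n u : 1 < q -> (forall i, (i < n)%N -> u i = ord_max) ->
  psum q u n = vmax M q * (1 - (q ^+ n)^-1).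
Proof.
move=> q1; elim: n => [|n IH] h; first by rewrite psum0 expr0 invr1 subrr mulr0.
rewrite psumS IH => [|i ni]; last by apply: h; lia.
rewrite h //= exprS.
have -> : M%:R = q * vmax M q - vmax M q by rewrite vmaxE //; ring.
by field; rewrite expf_neq0 ?gt_eqF //; lra.
Qed.

Lemma psum_switch_word q K : 1 < q -> (0 < M)%N -> (0 < K)%N ->
  psum q (switch_word K) (K + K) =
  vmax M q * (1 - (q ^+ K)^-1) + (q ^+ K)^-1 * (q ^+ K)^-1.
Proof.
move=> q1 M0 K0; rewrite psumD; last lra.
rewrite psum_ord_max => // [|i iK]; last by rewrite /switch_word iK.
congr (_ + _); rewrite mulrC; congr (_ * _).
case: K K0 => // K _; rewrite psumS (eq_psum q _ (fun=> ord0)); last first.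
  move=> i iK; rewrite /dshift /switch_word.
  have -> : (K.+1 + i < K.+1)%N = false by lia.
  by have -> : (K.+1 + i == K.+1 + K.+1.-1)%N = false by lia.
have -> : psum q (fun=> ord0 : 'I_M.+1) K = 0.
  by rewrite /psum big1 // => i _; rewrite mul0r.
rewrite add0r /dshift /switch_word.
have -> : (K.+1 + K < K.+1)%N = false by lia.
by rewrite /= eqxx inordK // mul1r.
Qed.

(** The bound 3/2 is uniform in [K]: the approximation rate [(2/3)^N] has to be fixed before the
    base, which depends on [K]. *)
Lemma switch_base_exists K : (0 < M)%N -> (0 < K)%N ->
  exists2 q : R, 3/2 < q < M.+1%:R & word_base (K + K) (switch_word K) q.
Proof.
move=> M0 K0.
have M1 : 1 <= M%:R :> R by rewrite ler1n.
(* With [t = q^-K] and [c = vmax M q], [word_base] reads [(1 + t) / (1 + t^3) < c < 1 + t]. A zero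
   of [f] puts [c] at [1 + t - t^3 / 2], strictly between. *)
pose f (q : R) := vmax M q - 1 - (q ^+ K)^-1 + (q ^+ K)^-1 * (q ^+ K)^-1 * (q ^+ K)^-1 / 2.
have tq q : 3/2 <= q -> 0 < (q ^+ K)^-1 <= 2/3.
  move=> q1; rewrite invr_gt0 exprn_gt0 /=; last lra.
  rewrite -exprVn; case: K K0 {f} => // K _; rewrite exprS.
  have h : q^-1 <= 2/3 by rewrite -[2/3]invf_div lef_pV2 ?posrE; lra.
  have q0 : 0 <= q^-1 by rewrite invr_ge0; lra.
  have : q^-1 ^+ K <= 1 by rewrite exprn_ile1; lra.
  have : 0 <= q^-1 ^+ K by rewrite exprn_ge0.
  nra.
have MR : M.+1%:R = M%:R + 1 :> R by rewrite natr1.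
have f2 : f M.+1%:R < 0.
  rewrite /f; have := tq M.+1%:R ltac:(lra); rewrite /vmax.
  set t := (_ ^+ _)^-1; have -> : M%:R / (M.+1%:R - 1) = 1 :> R.
    by rewrite MR addrK divff //; apply: lt0r_neq0; lra.
  nra.
have f1 : 0 < f (3/2).
  rewrite /f; have := tq (3/2) ltac:(lra); rewrite /vmax.
  set t := (_ ^+ _)^-1; have -> : M%:R / (3/2 - 1) = 2 * M%:R :> R by field.
  nra.
have [||| q qi fq] := @ivt_decreasing R f (3/2) M.+1%:R 0; try lra.
  move=> t ti; have t0 : t ^+ K != 0 by rewrite expf_neq0 // gt_eqF; lra.
  have cV : {for t, continuous (fun q : R => (q ^+ K)^-1)}.
    by apply: cvgV => //; exact: exprn_continuous.
  apply: cvgD; first apply: cvgB; first apply: cvgB.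
  - by apply: vmax_continuous; lra.
  - exact: cvg_cst.
  - exact: cV.
  - by apply: cvgMr_tmp; do 2 (apply: cvgM => //).
exists q.
  have /andP[a b] := qi.
  rewrite !lt_neqAle a b !andbT; apply/andP; split; apply/eqP => e.
    by move: f1; rewrite e fq ltxx.
  by move: f2; rewrite -e fq ltxx.
have q1 : 1 < q by lra.
rewrite /word_base psum_switch_word //.
have := tq q ltac:(lra); move: fq; rewrite /f exprD invfM.
set t := (q ^+ K)^-1; set c := vmax M q => fq t1.
have -> : c = 1 + t - t * t * t / 2 by lra.
have t3 : 0 < t * t * t by rewrite !mulr_gt0; lra.
split; nra.
Qed.

Lemma prefix_lt_of_first m u (w : nat -> 'I_M.+1) K : (K <= m)%N ->
  (forall i, (i < K)%N -> w i = ord_max) ->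
  (exists2 i, (i < K)%N & (u i < M)%N) -> prefix_lt m u w.
Proof.
move=> Km wM ex; have {}ex : exists i, (i < K)%N && (u i < M)%N.
  by case: ex => i a b; exists i; rewrite a b.
case: (ex_minnP ex) => j /andP[jK uj] jmin.
exists j; first exact: leq_trans Km.
split; last by rewrite wM.
move=> i ij; rewrite wM; last lia.
apply: val_inj => /=; apply/eqP; rewrite eqn_leq digit_le leqNgt.
by apply/negP => ui; have := jmin i; rewrite ui; lia.
Qed.

Lemma blocks_afterE N K u a :
  blocks_after N K u (N.+1 + a)%N = if odd (a %/ K) then ord0 else ord_max.
Proof.
rewrite /blocks_after.
have -> : (N.+1 + a < N)%N = false by lia.
have -> : (N.+1 + a == N)%N = false by lia.
by rewrite addKn.
Qed.

(** Such a run is one of the blocks. For [k < N] it would contain the places [N] and [N+1], with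
    digits [0] and [M]; for [k > N] the change of digit after [k] marks a block boundary; for
    [k = N] the first block starts. *)
Lemma blocks_after_next N K u k : (0 < M)%N -> (N.+1 < K)%N ->
  let d := blocks_after N K u in
  ((d k < M)%N -> (forall i, (i < K)%N -> d (k.+1 + i)%N = ord_max) ->
    forall i, (i < K)%N -> d (k.+1 + K + i)%N = ord0) /\
  ((0 < d k)%N -> (forall i, (i < K)%N -> d (k.+1 + i)%N = ord0) ->
    forall i, (i < K)%N -> d (k.+1 + K + i)%N = ord_max).
Proof.
move=> M0 NK d; have K0 : (0 < K)%N by lia.
have dN : d N = ord0 by rewrite /d /blocks_after ltnn eqxx.
have dNS : d N.+1 = ord_max.
  by rewrite -[N.+1]addn0 /d blocks_afterE div0n.
have [kN|kN|kN] := ltngtP k N.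
- split => _ h; exfalso.
    have := h (N - k.+1)%N ltac:(lia); rewrite subnKC // dN.
    by move=> /(congr1 (@nat_of_ord _)) /=; lia.
  have := h (N.+1 - k.+1)%N ltac:(lia); rewrite subnKC ?dNS; last lia.
  by move=> /(congr1 (@nat_of_ord _)) /=; lia.
- have [a ak] : exists a, k = (N.+1 + a)%N by exists (k - N.+1)%N; lia.
  have E i : d (k.+1 + i)%N = if odd ((a.+1 + i) %/ K) then ord0 else ord_max.
    have -> : (k.+1 + i = N.+1 + (a.+1 + i))%N by lia.
    exact: blocks_afterE.
  have Ek : d k = if odd (a %/ K) then ord0 else ord_max.
    by rewrite ak /d blocks_afterE.
  have shiftK i : (K %| a.+1)%N -> (i < K)%N ->
      d (k.+1 + K + i)%N = if odd (a.+1 %/ K) then ord_max else ord0.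
    move=> Ka iK; rewrite -addnA E divnDl // divnDl ?dvdnn // divnn K0.
    by rewrite [(i %/ K)%N]divn_small // addn0 addn1 /=; case: odd.
  have S := divnS a K0.
  split => dk h i iK.
    have := h 0%N K0; rewrite E addn0; move: dk; rewrite Ek.
    case: ifP => [oa _|_]; last by rewrite /= ltnn.
    case: ifP => [_ /(congr1 (@nat_of_ord _)) /=|oS _]; first lia.
    have Ka : (K %| a.+1)%N by move: oS; rewrite S; case: (K %| _)%N; rewrite //= oa.
    by rewrite shiftK // oS.
  have := h 0%N K0; rewrite E addn0; move: dk; rewrite Ek.
  case: ifP => [oa|oa _]; first by rewrite /= ltnn.
  case: ifP => [oS _|_ /(congr1 (@nat_of_ord _)) /=]; last lia.
  have Ka : (K %| a.+1)%N by move: oS; rewrite S; case: (K %| _)%N; rewrite //= oa.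
  by rewrite shiftK // oS.
- rewrite kN; split; last by rewrite dN.
  move=> _ _ i iK; rewrite -addnA /d blocks_afterE divnDl ?dvdnn // divnn K0.
  by rewrite [(i %/ K)%N]divn_small.
Qed.

(** A tail not starting with [M^K] drops below the word within [K] digits; one that does continues
    with [0^K], below [0^(K-1) 1]. Reflected tails behave alike. *)
Lemma blocks_after_admissible N K u : (0 < M)%N -> (N.+1 < K)%N ->
  admissible (K + K) (switch_word K) (blocks_after N K u).
Proof.
move=> M0 NK k; set d := blocks_after N K u.
have [up down] := blocks_after_next N K u k M0 NK; rewrite -/d in up down.
have K0 : (0 < K)%N by lia.
have main (e : nat -> 'I_M.+1) : (forall i, (i < K)%N -> e i = ord_max) ->
    (forall i, (i < K)%N -> e (K + i)%N = ord0) ->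
    prefix_lt (K + K) e (switch_word K).
  move=> e1 e2; exists (K + K.-1)%N; first lia.
  split=> [i iK|].
    rewrite /switch_word; have [lt|ge] := ltnP i K; first exact: e1.
    have -> : (i == K + K.-1)%N = false by lia.
    by rewrite -(subnKC ge) e2 //; lia.
  rewrite e2; last lia.
  rewrite /switch_word eqxx; have -> : (K + K.-1 < K)%N = false by lia.
  by rewrite inordK.
have wM i : (i < K)%N -> switch_word K i = ord_max by rewrite /switch_word => ->.
have first (e : nat -> 'I_M.+1) : (exists2 i, (i < K)%N & (e i < M)%N) \/
    (forall i, (i < K)%N -> e i = ord_max).
  have [ex|nex] := pselect (exists2 i, (i < K)%N & (e i < M)%N); first by left.
  right=> i iK; apply: val_inj => /=; apply/eqP.
  rewrite eqn_leq digit_le leqNgt; apply/negP => h; apply: nex; by exists i.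
split=> dk.
  have [ex|all] := first (dshift k.+1 d).
    by apply: (prefix_lt_of_first _ _ _ K) => //; lia.
  apply: main => // i iK; rewrite /dshift addnA; exact: up.
have [ex|all] := first (refl (dshift k.+1 d)).
  by apply: (prefix_lt_of_first _ _ _ K) => //; lia.
apply: main => // i iK; rewrite /refl /dshift addnA down //.
  by apply: val_inj; rewrite /= subnn.
by move=> j /all h; apply: rev_ord_inj; rewrite [LHS]h; apply: val_inj; rewrite /= subn1.
Qed.

Lemma Xiso_near_unit_interval x eps : (0 < M)%N -> 0 <= x <= 1 -> 0 < eps ->
  exists2 y, Xiso R M y & `|x - y| < eps.
Proof.
move=> M0 x01 eps0.
(* [2 M] bounds [vmax], hence the difference of two tail values, in every base above 3/2. *)
have [N _ /(_ N)] := @geometric_lt R (2/3) (2 * M%:R) eps ltac:(lra) eps0.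
rewrite /= leqnn => /(_ isT) Neps.
have [q q32 wb] := switch_base_exists N.+2 M0 isT.
have q1M : 1 < q <= M.+1%:R by lra.
have q1 : 1 < q by lra.
have [u eu] : exists u : nat -> 'I_M.+1, ev q u = x.
  by apply: expansion_exists => //; have := vmax_ge1 q q1M; lra.
set d := blocks_after N N.+2 u.
have ad : admissible (N.+2 + N.+2) (switch_word N.+2) d.
  exact: blocks_after_admissible.
have dN : d N = ord0 by rewrite /d /blocks_after ltnn eqxx.
have dblk i : (i < N.+2)%N -> d (N.+1 + i)%N = switch_word N.+2 i.
  by move=> iN; rewrite /d blocks_afterE divn_small // /switch_word iN.
have dw := switch_word_doubled N.+2 M0 isT.
exists (ev q d).
  apply: (isolated_base q _ _ _ (N.+1 + N.+2) _ wb) => //.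
  - by lra.
  - exact: doubled_last_gt0.
  - by exists (N.+1 + 0)%N; rewrite dblk.
  - by apply: doubled_isolated => //; rewrite dN.
rewrite -eu (evD q u N q1) (evD q d N q1).
rewrite (eq_psum q d u N) => [|i iN]; last by rewrite /d /blocks_after iN.
have -> (a b c z : R) : a + b / z - (a + c / z) = (b - c) / z by ring.
apply: le_lt_trans Neps.
rewrite normrM [X in _ * X]ger0_norm; last by rewrite invr_ge0 exprn_ge0 //; lra.
rewrite -exprVn; apply: ler_pM => //; first by rewrite exprn_ge0 // invr_ge0; lra.
  have V : vmax M q <= 2 * M%:R.
    rewrite /vmax ler_pdivrMr; last lra.
    have : 0 <= M%:R :> R by []; nra.
  have a1 := ev_ge0 q (dshift N u) q1; have a2 := ev_le q (dshift N u) q1.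
  have b1 := ev_ge0 q (dshift N d) q1; have b2 := ev_le q (dshift N d) q1.
  by rewrite ler_norml; lra.
have q0 : 0 <= q^-1 by rewrite invr_ge0; lra.
have q23 : q^-1 <= 2/3 by rewrite -[2/3]invf_div lef_pV2 ?posrE; lra.
by rewrite lerXn2r ?nnegrE.
Qed.

End UnitInterval.

(** * Thue-Morse words for M = 1 *)

Section Doubling.
Implicit Types (d e w : nat -> 'I_2) (k m n : nat).

(* [0 psi(e)] is the image of [0 e] under the Thue-Morse substitution
   [0 -> 01], [1 -> 10]. *)
Definition psi e : nat -> 'I_2 := fun i =>
  if i is j.+1 then (if odd j then rev_ord (e j./2) else e j./2) else ord_max.

(** The first [2^(n+1)] digits are those of the Thue-Morse sequence without its leading 0. *)
Definition thue_morse n : nat -> 'I_2 := iter n psi (fun=> ord_max).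

Lemma psi_odd e k : psi e k.*2.+1 = e k.
Proof. by rewrite /psi odd_double doubleK. Qed.

Lemma psi_even e k : psi e k.*2.+2 = rev_ord (e k).
Proof. by rewrite /psi /= odd_double /= uphalf_double. Qed.

Lemma psi_agree e w m : (forall i, (i < m)%N -> e i = w i) ->
  forall i, (i < m.*2.+1)%N -> psi e i = psi w i.
Proof.
move=> h [|i] //= im; have : (i./2 < m)%N by lia.
by move=> /h ->.
Qed.

Lemma psi_prefix_lt m e w :
  prefix_lt m e w -> prefix_lt (m + m) (psi e) (psi w).
Proof.
move=> [j jm [agree lt]]; exists j.*2.+1; first lia.
by split; [exact: psi_agree|rewrite !psi_odd].
Qed.

Variant parity_spec : nat -> Type :=
| ParityZero : parity_spec 0
| ParityOdd k : parity_spec k.*2.+1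
| ParityEven k : parity_spec k.*2.+2.

Lemma parityP i : parity_spec i.
Proof.
case: i => [|i]; first by constructor.
by rewrite -(odd_double_half i); case: odd; constructor.
Qed.

(** The image [01] of [e k = 0] ends in 1, which serves as the leading 1 of [psi]. *)
Lemma dshift_psi e k : e k = ord0 -> dshift k.*2.+2 (psi e) = psi (dshift k.+1 e).
Proof.
move=> ek; apply/funext => i; rewrite /dshift; case: (parityP i) => [|j|j].
- by rewrite addn0 psi_even ek; apply: val_inj.
- have -> : (k.*2.+2 + j.*2.+1 = (k.+1 + j).*2.+1)%N by lia.
  by rewrite !psi_odd.
- have -> : (k.*2.+2 + j.*2.+2 = (k.+1 + j).*2.+2)%N by lia.
  by rewrite !psi_even.
Qed.

Lemma refl_dshift_psi e k : e k = ord_max ->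
  refl (dshift k.*2.+2 (psi e)) = psi (refl (dshift k.+1 e)).
Proof.
move=> ek; apply/funext => i; rewrite /refl /dshift; case: (parityP i) => [|j|j].
- by rewrite addn0 psi_even ek rev_ordK.
- have -> : (k.*2.+2 + j.*2.+1 = (k.+1 + j).*2.+1)%N by lia.
  by rewrite !psi_odd.
- have -> : (k.*2.+2 + j.*2.+2 = (k.+1 + j).*2.+2)%N by lia.
  by rewrite !psi_even.
Qed.

Lemma digit2 (i : 'I_2) : i = ord0 \/ i = ord_max.
Proof.
by move: i => [[|[|i]] h] //; [left|right]; apply: val_inj.
Qed.

(** Tails from an odd place start with [01] or [10], while [psi w] starts with [11]. Tails from an
    even place, reflected if they follow a 1, are [psi] of the corresponding tails of [e]. *)
Lemma psi_admissible m w e : (0 < m)%N -> w 0%N = ord_max ->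
  admissible m w e -> admissible (m + m) (psi w) (psi e).
Proof.
move=> m0 w0 ad.
have pair t : t 1%N = rev_ord (t 0%N) -> prefix_lt (m + m) t (psi w).
  move=> t1; have [t0|t0] := digit2 (t 0%N).
    by exists 0%N; [lia|split => //; rewrite t0].
  exists 1%N; first lia.
  by split=> [[|//] _|]; rewrite ?t1 t0 //= w0.
have pair2 k : prefix_lt (m + m) (dshift k.*2.+1 (psi e)) (psi w) /\
    prefix_lt (m + m) (refl (dshift k.*2.+1 (psi e))) (psi w).
  by split; apply: pair; rewrite /refl /dshift addn0 addn1 psi_odd psi_even.
move=> i; case: (parityP i) => [|k|k]; [|rewrite psi_odd|].
- by split=> _; [exact: proj1 (pair2 0%N)|exact: proj2 (pair2 0%N)].
- have [ek|ek] := digit2 (e k); rewrite ek; split => // _.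
    rewrite dshift_psi //; apply: psi_prefix_lt; apply: (proj1 (ad k)).
    by rewrite ek.
  rewrite refl_dshift_psi //; apply: psi_prefix_lt; apply: (proj2 (ad k)).
  by rewrite ek.
- by split=> _; [exact: proj1 (pair2 k.+1)|exact: proj2 (pair2 k.+1)].
Qed.

(** Digits of [psi w] at distance [2L] come from digits of [w] at distance [L]; the leading 1 faces
    the complement of [w L.-1 = 1]. *)
Lemma psi_doubled L w : w 0%N = ord_max -> doubled L w -> doubled (L + L) (psi w).
Proof.
move=> w0 [L0 wL wrefl wlast].
have last1 k : (w k = 1 :> nat)%N -> psi w k.*2.+1 = ord_max.
  by move=> h; rewrite psi_odd; apply: val_inj.
have rev1 (a b : 'I_2) : (a + b = 1)%N -> (rev_ord a + rev_ord b = 1)%N.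
  by case: (digit2 a) => ->; case: (digit2 b) => ->.
have EL : ((L + L).-1 = L.-1.*2.+1)%N by lia.
have ELL : (L + L + (L + L).-1 = (L + L.-1).*2.+1)%N by lia.
have LL1 : (w L.-1 = 1 :> nat)%N by have := digit_le w L.-1; lia.
split; rewrite ?ELL ?EL ?psi_odd //; first lia.
move=> i; case: (parityP i) => [|k|k] ik.
- have -> : (L + L + 0 = L.-1.*2.+2)%N by lia.
  by rewrite psi_even /= LL1.
- have -> : (L + L + k.*2.+1 = (L + k).*2.+1)%N by lia.
  by rewrite !psi_odd wrefl //; lia.
- have -> : (L + L + k.*2.+2 = (L + k).*2.+2)%N by lia.
  by rewrite !psi_even rev1 // wrefl //; lia.
Qed.

Lemma thue_morse0 n : thue_morse n 0%N = ord_max.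
Proof. by case: n. Qed.

Lemma thue_morse_doubled n : doubled (2 ^ n) (thue_morse n).
Proof.
elim: n => [|n IH]; first by split.
by rewrite expnS mul2n -addnn; apply: psi_doubled => //; exact: thue_morse0.
Qed.

(** The hypotheses of [doubled_isolated] for the word [thue_morse n]. *)
Definition level n e := admissible (2 ^ n + 2 ^ n) (thue_morse n) e /\
  exists2 k, e k = ord0 & forall i, (i < 2 ^ n)%N -> e (k.+1 + i)%N = thue_morse n i.

Lemma level_psi n e : level n e -> level n.+1 (psi e).
Proof.
move=> [ad [k ek blk]]; rewrite /level expnS mul2n -addnn; split.
  by apply: psi_admissible => //; [have := expn_gt0 2 n; lia|exact: thue_morse0].
exists k.*2.+1; first by rewrite psi_odd.
move=> i iL; have -> : psi e (k.*2.+2 + i)%N = dshift k.*2.+2 (psi e) i by [].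
by rewrite dshift_psi //; apply: (psi_agree _ _ (2 ^ n)) => //; lia.
Qed.

(** [1^k (10)^oo], which tends to [1^oo] as [k] grows. *)
Definition ramp k : nat -> 'I_2 := fun i =>
  if (i < k)%N || ~~ odd (i - k) then ord_max else ord0.

(** At level 0 the word is [11]: admissibility forbids [11] after a 0 and [00] after a 1. *)
Lemma level_ramp k : level 0 (ramp k).
Proof.
have r1 i : (i < k)%N || ~~ odd (i - k) -> ramp k i = ord_max by rewrite /ramp => ->.
have r0 i : ~~ ((i < k)%N || ~~ odd (i - k)) -> ramp k i = ord0.
  by rewrite /ramp => /negbTE->.
have two (t : nat -> 'I_2) : t 0%N = ord0 \/ t 1%N = ord0 ->
    prefix_lt 2 t (fun=> ord_max).
  have [t0 _|t0 [|t1]] := digit2 (t 0%N); first by exists 0%N => //; rewrite t0.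
    by rewrite t0.
  by exists 1%N => //; split=> [[|//] _|]; rewrite ?t0 ?t1.
split; last by exists k.+1 => [|[|//] _]; [apply: r0|apply: r1]; lia.
move=> i; split=> di; apply: two.
  right; apply: r0; rewrite /dshift.
  have : ~~ ((i < k)%N || ~~ odd (i - k)).
    by apply/negP => /r1 h; move: di; rewrite h.
  lia.
have [c|c] := boolP ((i.+1 < k)%N || ~~ odd (i.+1 - k)).
  by left; rewrite /refl /dshift addn0 r1 //; apply: val_inj.
by right; rewrite /refl /dshift r1; [apply: val_inj|lia].
Qed.

Lemma level_iter n m e : level m e -> level (n + m) (iter n psi e).
Proof. by move=> h; elim: n => //= n IH; exact: level_psi. Qed.

Lemma ramp1 : ramp 1 = thue_morse 1.
Proof. apply/funext => -[|i] //; rewrite /ramp /= subn1 /=.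
by case: odd; rewrite //=; apply: val_inj. Qed.

Lemma level_iter_ramp n k : level n (iter n psi (ramp k)).
Proof. by rewrite -[n in level n]addn0; apply: level_iter; exact: level_ramp. Qed.

(** [psi] maps [1^oo] to [1(10)^oo], which is a ramp. *)
Lemma level_thue_morse n : level n (thue_morse n.+1).
Proof.
have -> : thue_morse n.+1 = iter n psi (ramp 1).
  by rewrite ramp1 /thue_morse iterSr.
exact: level_iter_ramp.
Qed.

Lemma iter_ramp_agree n k i : (i < k)%N -> iter n psi (ramp k) i = thue_morse n i.
Proof.
elim: n i => [|n IH] i ik /=; first by rewrite /ramp ik.
by apply: (psi_agree _ _ k) => //; lia.
Qed.

End Doubling.

(** * Values and base intervals of the Thue-Morse words *)

Section Values.
Context {R : realType}.
Implicit Types (d e w : nat -> 'I_2) (k m n : nat) (q x y : R).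

Lemma rev_ord2 (i : 'I_2) : (rev_ord i)%:R = 1 - i%:R :> R.
Proof. by have [->|->] := digit2 i; rewrite /= ?subr0 ?subrr. Qed.

(** The pair [e k, 1 - e k] contributes [(1 - q^-1) (e k) (q^2)^-(k+1) + q^-(2k+3)]; the second
    terms form a geometric series. *)
Lemma psum_psi q e m : 1 < q -> psum q (psi e) m.*2.+1 =
  q^-1 + (1 - q^-1) * psum (q ^+ 2) e m +
  (1 - (q ^+ 2)^-1 ^+ m) / (q * (q ^+ 2 - 1)).
Proof.
move=> q1; have q0 : q != 0 by rewrite gt_eqF //; lra.
have q21 : q ^+ 2 - 1 != 0 by rewrite gt_eqF //; nra.
elim: m => [|m IH].
  by rewrite double0 psumS !psum0 !expr0 expr1 /= subrr mul0r mulr0 !addr0 add0r mul1r.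
rewrite doubleS psumS psumS IH psi_odd psi_even rev_ord2 psumS -[X in X + _ = _]addrA.
have E : q ^+ m.*2.+2 = q ^+ 2 * (q ^+ 2) ^+ m.
  by rewrite -muln2 mulnC -!exprM -exprD; congr (_ ^+ _); lia.
rewrite [q ^+ m.*2.+3]exprS E !exprVn [(q ^+ 2) ^+ m.+1]exprS.
have : (q ^+ 2) ^+ m != 0 by rewrite !expf_neq0.
move: (q ^+ 2 ^+ m) (psum _ _ _) => z p z0; field.
by rewrite z0 q0 q21.
Qed.

Lemma ev_psi q e : 1 < q -> ev q (psi e) =
  q^-1 + (1 - q^-1) * ev (q ^+ 2) e + 1 / (q * (q ^+ 2 - 1)).
Proof.
move=> q1; have q0 : 0 < q by lra.
have q21 : 1 < q ^+ 2 by nra.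
set z := 1 / _; have z0 : 0 <= z by rewrite divr_ge0 // mulr_ge0; nra.
have i01 : 0 <= q^-1 <= 1 by rewrite invr_ge0 invf_le1; lra.
apply/eqP; rewrite -subr_eq0 -normr_le0.
apply: (geometric_le0 (q ^+ 2)^-1 (vmax 1 q + vmax 1 (q ^+ 2) + z)).
  exact: inv_in01.
move=> m; set r := (q ^+ 2)^-1 ^+ m.
have r0 : 0 <= r by rewrite exprn_ge0 // invr_ge0; lra.
rewrite (evD q _ m.*2.+1 q1) psum_psi // (evD (q ^+ 2) e m q21).
have -> : (q ^+ m.*2.+1)^-1 = q^-1 * r.
  by rewrite /r exprS invfM exprVn -exprM mul2n.
rewrite -[_ / _ ^+ m]/(_ * _) -exprVn -/r.
have -> : (1 - r) / (q * (q ^+ 2 - 1)) = (1 - r) * z by rewrite /z mul1r.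
have a1 := ev_ge0 q (dshift m.*2.+1 (psi e)) q1.
have a2 := ev_le q (dshift m.*2.+1 (psi e)) q1.
have b1 := ev_ge0 (q ^+ 2) (dshift m e) q21.
have b2 := ev_le (q ^+ 2) (dshift m e) q21.
move: (ev q _) (ev _ (dshift m e)) a1 a2 b1 b2 => a b a1 a2 b1 b2.
set lhs := (X in `|X|).
have -> : lhs = (q^-1 * a - (1 - q^-1) * b - z) * r by rewrite /lhs; ring.
rewrite normrM [`|r|]ger0_norm //; apply: ler_wpM2r => //.
rewrite ler_norml; apply/andP; split; nra.
Qed.

(** Expands to the sum over [j < 2^n] of [(-1)^(t j) q^-j], with [t] the Thue-Morse sequence. *)
Definition tm_prod n q : R := \prod_(i < n) (1 - (q ^+ (2 ^ i))^-1).

Lemma tm_prodS n q : tm_prod n.+1 q = tm_prod n q * (1 - (q ^+ (2 ^ n))^-1).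
Proof. by rewrite /tm_prod big_ord_recr. Qed.

Lemma tm_prod_sqr n q : tm_prod n.+1 q = (1 - q^-1) * tm_prod n (q ^+ 2).
Proof.
rewrite /tm_prod big_ord_recl expr1; congr (_ * _).
by apply: eq_bigr => i _; rewrite -exprM expnS.
Qed.

Lemma vmax1 q : vmax 1 q = 1 / (q - 1).
Proof. by []. Qed.

Lemma psum_thue_morse n q : 1 < q ->
  2 * (psum q (thue_morse n) (2 ^ n + 2 ^ n) - 1) =
  (vmax 1 q - 1) * (1 - (q ^+ (2 ^ n.+1))^-1) - tm_prod n.+1 q.
Proof.
elim: n q => [|n IH] q q1.
  rewrite psum_ord_max // tm_prodS /tm_prod big_ord0 vmax1 /= expr1.
  field; apply/andP; split; rewrite gt_eqF //; lra.
have q21 : 1 < q ^+ 2 by nra.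
have q0 : 0 < q by lra.
have [L0 _ _ last] := thue_morse_doubled n.
(* [psum_psi] takes an odd number of digits; the digit appended to the first [2^(n+2)] is the
   complement of the last digit 1 of the doubled word, hence 0. *)
have E : psum q (thue_morse n.+1) (2 ^ n.+1 + 2 ^ n.+1) =
    psum q (psi (thue_morse n)) (2 ^ n + 2 ^ n).*2.+1.
  rewrite psumS -[thue_morse n.+1]/(psi (thue_morse n)) expnS.
  have -> : ((2 ^ n + 2 ^ n).*2 = (2 ^ n + (2 ^ n).-1).*2.+2)%N by lia.
  rewrite psi_even [in X in _ = _ + X]rev_ord2.
  have -> : thue_morse n (2 ^ n + (2 ^ n).-1)%N = ord_max.
    apply: val_inj => /=; have := digit_le (thue_morse n) (2 ^ n).-1.
    by have := digit_le (thue_morse n) (2 ^ n + (2 ^ n).-1); lia.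
  by rewrite subrr mul0r addr0; congr psum; lia.
rewrite E psum_psi // tm_prod_sqr.
have e2 : (q ^+ 2)^-1 ^+ (2 ^ n + 2 ^ n) = (q ^+ (2 ^ n.+2))^-1.
  by rewrite exprVn -exprM addnn -mul2n -expnS.
have := IH _ q21; rewrite -exprM -expnS e2 !vmax1.
move: (q ^+ _)^-1 (psum _ _ _) (tm_prod _ _) => s p t h.
have -> : p = (1 / (q ^+ 2 - 1) - 1) * (1 - s) / 2 - t / 2 + 1 by lra.
field; repeat (apply/andP; split); rewrite gt_eqF //; nra.
Qed.

Lemma ev_ord_max M q : 1 < q -> ev q (fun=> ord_max : 'I_M.+1) = vmax M q.
Proof.
move=> q1; have q0 : 0 < q by lra.
apply: (ev_eq_of_remainders _ _ _ (fun=> vmax M q) (vmax M q)) => // n.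
  by rewrite psum_ord_max //; ring.
by rewrite ger0_norm // vmax_ge0.
Qed.

Lemma ev_thue_morse n q : 1 < q ->
  let s := (q ^+ (2 ^ n))^-1 in
  2 * ev q (thue_morse n) =
  vmax 1 q + 1 - tm_prod n q * (1 - 2 * s) / (1 - s).
Proof.
elim: n q => [|n IH] q q1 /=.
  rewrite ev_ord_max // /tm_prod big_ord0 vmax1 expr1.
  field; repeat (apply/andP; split); rewrite gt_eqF //; lra.
have q21 : 1 < q ^+ 2 by nra.
have q0 : 0 < q by lra.
rewrite ev_psi // tm_prod_sqr; have := IH _ q21; rewrite /= -exprM -expnS !vmax1.
rewrite -!mulrA; move: (_ / (1 - _)) (ev _ _) (tm_prod _ _) => s p t h.
have -> : p = (1 / (q ^+ 2 - 1) + 1 - t * s) / 2 by lra.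
field; repeat (apply/andP; split); rewrite gt_eqF //; nra.
Qed.

Lemma expV_bounds q m : 1 < q -> (0 < m)%N -> 0 < (q ^+ m)^-1 <= q^-1.
Proof.
move=> q1; case: m => // m _; have q0 : 0 < q by lra.
rewrite invr_gt0 exprn_gt0 //= lef_pV2 ?posrE ?exprn_gt0 // exprS.
by rewrite ler_peMr ?(ltW q0) // exprn_ege1 // ltW.
Qed.

Lemma expV_le q q' m : 0 < q -> q <= q' -> (q' ^+ m)^-1 <= (q ^+ m)^-1.
Proof.
move=> q0 qq'; rewrite lef_pV2 ?posrE ?exprn_gt0 //; last lra.
by rewrite lerXn2r ?nnegrE; lra.
Qed.

Lemma inv_lt1 q : 1 < q -> 0 < q^-1 < 1.
Proof. by move=> q1; rewrite invr_gt0 invf_lt1; lra. Qed.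

Lemma tm_prod_bounds n q : 1 < q -> 0 < tm_prod n q <= 1.
Proof.
move=> q1; elim: n => [|n IH]; first by rewrite /tm_prod big_ord0 ltr01 lexx.
rewrite tm_prodS; have := expV_bounds q (2 ^ n) q1 ltac:(by rewrite expn_gt0).
have := inv_lt1 q q1; nra.
Qed.

Lemma tm_prod_le n q q' : 1 < q -> q <= q' -> tm_prod n q <= tm_prod n q'.
Proof.
move=> q1 qq'; elim: n => [|n IH]; first by rewrite /tm_prod !big_ord0.
rewrite !tm_prodS; have := tm_prod_bounds n q q1.
have := expV_bounds q (2 ^ n) q1 ltac:(by rewrite expn_gt0).
have := expV_le q q' (2 ^ n) ltac:(lra) qq'.
have := inv_lt1 q q1; nra.
Qed.

(* The zero of [level_gap n] is the base whose quasi-greedy expansion of 1 is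
   periodic with period [a abar], where [a] is the prefix of [thue_morse n] of
   length [2 ^ n]. *)
Definition level_gap n q : R :=
  tm_prod n q - (vmax 1 q - 1) * (1 + (q ^+ (2 ^ n))^-1).

Lemma vmax1_lt q q' : 1 < q -> q < q' -> vmax 1 q' < vmax 1 q.
Proof.
by move=> q1 qq'; rewrite !vmax1 !mul1r ltf_pV2 ?posrE; lra.
Qed.

Lemma level_gap_lt n q q' : 1 < q -> q < q' -> q' <= 2 ->
  level_gap n q < level_gap n q'.
Proof.
move=> q1 qq' q'2; rewrite /level_gap.
have := tm_prod_le n q q' q1 (ltW qq'); have := vmax1_lt q q' q1 qq'.
have := expV_le q q' (2 ^ n) ltac:(lra) (ltW qq').
have := expV_bounds q' (2 ^ n) ltac:(lra) ltac:(by rewrite expn_gt0).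
have : 1 <= vmax 1 q' by apply: vmax_ge1; lra.
nra.
Qed.

Lemma tm_prod_continuous n q : 1 < q -> {for q, continuous (tm_prod n)}.
Proof.
move=> q1; elim: n => [|n IH].
  have -> : tm_prod 0 = (fun=> 1) by apply/funext => t; rewrite /tm_prod big_ord0.
  exact: cvg_cst.
have -> : tm_prod n.+1 = (fun t => tm_prod n t * (1 - (t ^+ (2 ^ n))^-1)).
  by apply/funext => t; rewrite tm_prodS.
apply: cvgM => //; apply: cvgB; first exact: cvg_cst.
apply: cvgV; last exact: exprn_continuous.
by rewrite expf_neq0 // gt_eqF //; lra.
Qed.

Lemma level_gap_continuous n q : 1 < q -> {for q, continuous (level_gap n)}.
Proof.
move=> q1; apply: cvgB; first exact: tm_prod_continuous.
apply: cvgM.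
  by apply: cvgB; [exact: vmax_continuous|exact: cvg_cst].
apply: cvgD; first exact: cvg_cst.
apply: cvgV; last exact: exprn_continuous.
by rewrite expf_neq0 // gt_eqF //; lra.
Qed.

Lemma level_root_exists n :
  exists r, [/\ 3/2 < r, r < 2 & level_gap n r = 0].
Proof.
have gap2 : 0 < level_gap n 2.
  have -> : level_gap n 2 = tm_prod n 2.
    by rewrite /level_gap vmax1; field; rewrite expf_neq0.
  by have := tm_prod_bounds n 2; lra.
have gap32 : level_gap n (3/2) < 0.
  rewrite /level_gap vmax1; have -> : 1 / (3/2 - 1) - 1 = 1 :> R by field.
  have := tm_prod_bounds n (3/2) ltac:(lra).
  have := expV_bounds (3/2) (2 ^ n) ltac:(lra) ltac:(by rewrite expn_gt0).
  lra.
have [|||r /andP[ra rb] gr] := @ivt_decreasing R (fun t => - level_gap n t) (3/2) 2 0.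
- by lra.
- by move=> t t1; apply: cvgN; apply: level_gap_continuous; lra.
- by lra.
have {}gr : level_gap n r = 0 by lra.
exists r; split => //; rewrite lt_neqAle ?ra ?rb andbT; apply/eqP => e.
  by move: gap32; rewrite e gr ltxx.
by move: gap2; rewrite -e gr ltxx.
Qed.

Definition level_root n : R := sval (cid (level_root_exists n)).

Lemma level_rootP n :
  [/\ 3/2 < level_root n, level_root n < 2 & level_gap n (level_root n) = 0].
Proof. exact: svalP (cid (level_root_exists n)). Qed.

Lemma level_gap_lt0 n q : 1 < q <= 2 -> (level_gap n q < 0) = (q < level_root n).
Proof.
move=> /andP[q1 q2]; have [r1 r2 r0] := level_rootP n.
have [lt|gt|->] := ltgtP q (level_root n); last by rewrite r0 ltxx.
  by rewrite -r0; apply: level_gap_lt => //; lra.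
have := level_gap_lt n _ _ (_ : 1 < level_root n) gt q2; rewrite r0 => h.
by apply/negbTE; rewrite -leNgt ltW // h //; lra.
Qed.

Lemma level_gap_gt0 n q : 1 < q <= 2 -> (0 < level_gap n q) = (level_root n < q).
Proof.
move=> /andP[q1 q2]; have [r1 r2 r0] := level_rootP n.
have [lt|gt|<-] := ltgtP (level_root n) q; last by rewrite r0 ltxx.
  by rewrite -r0; apply: level_gap_lt => //; lra.
have := level_gap_lt n _ _ q1 gt (ltW r2); rewrite r0 => h.
by apply/negbTE; rewrite -leNgt ltW.
Qed.

Lemma expV_double q n : (q ^+ (2 ^ n.+1))^-1 = (q ^+ (2 ^ n))^-1 * (q ^+ (2 ^ n))^-1.
Proof. by rewrite expnS mul2n -addnn exprD invfM. Qed.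

(** At the root of level [n], with [s = q^-(2^n)], the next gap equals [-2 (vmax - 1) s^2]. *)
Lemma level_root_lt n : level_root n < level_root n.+1.
Proof.
have [r1 r2 r0] := level_rootP n.
rewrite -level_gap_lt0; last lra.
move: r0; rewrite /level_gap tm_prodS expV_double.
have := expV_bounds (level_root n) (2 ^ n) ltac:(lra) ltac:(by rewrite expn_gt0).
have := vmax1_lt (level_root n) 2 ltac:(lra) r2.
have -> : vmax 1 2 = 1 :> R by rewrite vmax1; field.
set s := (_ ^+ _)^-1; set c := vmax 1 _ => c1 /andP[s0 _] r0.
have -> : tm_prod n (level_root n) = (c - 1) * (1 + s) by lra.
have s2 : 0 < (c - 1) * (s * s) by rewrite !mulr_gt0 //; lra.
lra.
Qed.

(** With [s = q^-(2^n)], [2 (psum - 1)] is [-(1 - s) level_gap n q], and adding [2 (vmax - 1) s^2]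
    turns it into [- level_gap n.+1 q]. The two halves of [word_base] are thus the signs of
    consecutive gaps. *)
Lemma level_word_base n q : level_root n < q < level_root n.+1 ->
  word_base (2 ^ n + 2 ^ n) (thue_morse n) q.
Proof.
move=> /andP[ra rb]; have [r1 _ _] := level_rootP n.
have [_ r2 _] := level_rootP n.+1; have q1 : 1 < q by lra.
have gn : 0 < level_gap n q by rewrite level_gap_gt0 //; lra.
have gS : level_gap n.+1 q < 0 by rewrite level_gap_lt0 //; lra.
have := psum_thue_morse n q q1.
rewrite /word_base exprD invfM -expV_double.
move: gn gS; rewrite /level_gap tm_prodS expV_double.
have := expV_bounds q (2 ^ n) q1 ltac:(by rewrite expn_gt0).
have := inv_lt1 q q1.
set s := (_ ^+ _)^-1; set c := vmax 1 _; set t := tm_prod _ _.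
set p := psum _ _ _ => i1 s1 gn gS h.
have : 0 < (t - (c - 1) * (1 + s)) * (1 - s) by rewrite mulr_gt0 //; lra.
split; lra.
Qed.

Lemma Xiso_level n q e : level_root n < q < level_root n.+1 -> level n e ->
  Xiso R 1 (ev q e).
Proof.
move=> qr [ad [k ek blk]]; have wb := level_word_base n q qr.
have [r1 _ _] := level_rootP n; have [_ r2 _] := level_rootP n.+1.
have dw := thue_morse_doubled n; have L0 : (0 < 2 ^ n)%N by rewrite expn_gt0.
apply: (isolated_base q _ _ _ (k.+1 + 2 ^ n) _ wb) => //.
- by lra.
- by rewrite addn_gt0 L0.
- exact: doubled_last_gt0.
- by exists (k.+1 + 0)%N; rewrite blk // thue_morse0.
- by apply: doubled_isolated => //; rewrite ek.
Qed.

(** [level_root 0] is the golden ratio. Below it the one-digit word [1] serves: its admissible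
    sequences are constant, so the first digit determines them. *)
Lemma Xiso_constant q : 1 < q < level_root 0 ->
  Xiso R 1 (ev q (fun=> ord_max : 'I_2)).
Proof.
move=> /andP[q1 qr]; have [_ r2 _] := level_rootP 0.
have : level_gap 0 q < 0 by rewrite level_gap_lt0 //; lra.
rewrite /level_gap /tm_prod big_ord0 expn0 expr1 vmax1 => g.
have gt0 : 0 < 1 + q - q * q.
  have q10 : q - 1 != 0 by rewrite gt_eqF //; lra.
  have q0 : q != 0 by rewrite gt_eqF //; lra.
  have E : 1 - (1 / (q - 1) - 1) * (1 + q^-1) = - (2 * (1 + q - q * q) / (q * (q - 1))).
    by field; rewrite q0 q10.
  move: g; rewrite E oppr_lt0 pmulr_lgt0; first lra.
  by rewrite invr_gt0 mulr_gt0; lra.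
apply: (isolated_base q 1 (fun=> ord_max) _ 1) => //.
- by lra.
- rewrite /word_base psumS psum0 add0r expr1 vmax1; split.
    by rewrite /= mul1r invf_lt1; lra.
  have -> : (ord_max : 'I_2)%:R / q + (1 / (q - 1) - 1) / q = 1 / (q * (q - 1)) :> R.
    by rewrite /=; field; apply/andP; split; rewrite gt_eqF //; lra.
  by rewrite mul1r invf_gt1 ?mulr_gt0; lra.
- move=> k; split=> // _; exists 0%N => //.
- by exists 0%N.
- move=> e ad e0; apply/funext; elim=> [|k ek]; first exact: e0.
  have [_] := ad k; rewrite ek => /(_ isT) [[|//] _ [_]].
  rewrite /refl /dshift addn0; have [->|->] := digit2 (e k.+1) => //.
Qed.

Lemma ev_prefix_dist q d e k : 1 < q -> (forall i, (i < k)%N -> d i = e i) ->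
  `|ev q d - ev q e| <= vmax 1 q * q^-1 ^+ k.
Proof.
move=> q1 h; rewrite (evD q d k q1) (evD q e k q1) (eq_psum q d e k h).
have -> (a b c z : R) : a + b / z - (a + c / z) = (b - c) / z by ring.
rewrite normrM [X in _ * X]ger0_norm; last by rewrite invr_ge0 exprn_ge0 //; lra.
rewrite -exprVn; apply: ler_wpM2r; first by rewrite exprn_ge0 // invr_ge0; lra.
have a1 := ev_ge0 q (dshift k d) q1; have a2 := ev_le q (dshift k d) q1.
have b1 := ev_ge0 q (dshift k e) q1; have b2 := ev_le q (dshift k e) q1.
by rewrite ler_norml; lra.
Qed.

(** The images of [ramp k] under [n] steps of [psi] are of level [n] and tend to [thue_morse n]. *)
Lemma closure_level_limit n q : level_root n < q < level_root n.+1 ->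
  closure (Xiso R 1) (ev q (thue_morse n)).
Proof.
move=> qr; have [r1 _ _] := level_rootP n; have q1 : 1 < q by lra.
apply: closure_approx => eps eps0.
have [k _ /(_ k)] := @geometric_lt R q^-1 (vmax 1 q) eps (inv_in01 q q1) eps0.
rewrite /= leqnn => /(_ isT) keps.
exists (ev q (iter n psi (ramp k))); first by apply: (Xiso_level n) => //; exact: level_iter_ramp.
apply: le_lt_trans keps; apply: ev_prefix_dist => // i ik.
by rewrite iter_ramp_agree.
Qed.

(** The partial sums converge uniformly on bases at least [a = (1 + q) / 2]. *)
Lemma ev_continuous q d : 1 < q -> {for q, continuous (fun t : R => ev t d)}.
Proof.
move=> q1; apply/cvgrPdist_lt => eps eps0.
pose a := (1 + q) / 2; have a1 : 1 < a by rewrite /a; lra.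
have aq : a < q by rewrite /a; lra.
have [n _ /(_ n)] := @geometric_lt R a^-1 (vmax 1 a) (eps / 4) (inv_in01 a a1) ltac:(lra).
rewrite /= leqnn => /(_ isT) neps.
have tail t : a <= t -> 0 <= ev t d - psum t d n <= eps / 4.
  move=> ta; have t1 : 1 < t by lra.
  rewrite (evD t d n t1) addrC addKr.
  have tn : 0 <= (t ^+ n)^-1 by rewrite invr_ge0 exprn_ge0 //; lra.
  rewrite mulr_ge0 ?ev_ge0 //=; apply: le_trans (ltW neps).
  rewrite exprVn; apply: ler_pM; rewrite ?ev_ge0 //.
    apply: (le_trans (ev_le _ _ t1)).
    by move: ta; rewrite le_eqVlt => /orP[/eqP->//|/(vmax1_lt a t a1)/ltW].
  by apply: expV_le => //; lra.
have cp := psum_continuous q d n ltac:(lra).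
have n1 : \forall t \near q, `|psum q d n - psum t d n| < eps / 4.
  by move/cvgrPdist_lt: cp; apply; lra.
have n2 : \forall t \near q, a < t by exact: lt_nbhsr.
near=> t.
have ta : a < t by near: t.
have pt : `|psum q d n - psum t d n| < eps / 4 by near: t.
have := tail q (ltW aq); have := tail t (ltW ta).
by move: pt; rewrite !ltr_norml; lra.
Unshelve. all: by end_near. Qed.

End Values.

(** * Covering (1, oo) for M = 1 *)

Section Covering.
Context {R : realType}.
Implicit Types (d : nat -> 'I_2) (n : nat) (a b q x : R).
Local Notation C := (closure (Xiso R 1)).
Local Notation root := (@level_root R).

Lemma closure_sweep d a b : 1 < a -> a < b ->
  (forall q, a < q < b -> C (ev q d)) -> forall q, a <= q <= b -> C (ev q d).
Proof.
move=> a1 ab h q /andP[aq qb]; have q1 : 1 < q by lra.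
rewrite [C](closure_id C).1; last exact: closed_closure.
apply: closure_approx => eps eps0.
have /cvgrPdist_lt /(_ _ eps0) /nbhs_ballP[del /= del0 near_q] := ev_continuous q d q1.
have [t [t1 t2 t3]] : exists t, [/\ a < t, t < b & `|q - t| < del].
  have [lt|ge] := ltP q b.
    exists (q + Num.min del (b - q) / 2).
    have m1 : Num.min del (b - q) <= del by rewrite ge_min lexx.
    have m2 : Num.min del (b - q) <= b - q by rewrite ge_min lexx orbT.
    have m3 : 0 < Num.min del (b - q) by rewrite lt_min del0; lra.
    by split; [lra|lra|rewrite ltr_norml; lra].
  exists (q - Num.min del (b - a) / 2).
  have m1 : Num.min del (b - a) <= del by rewrite ge_min lexx.
  have m2 : Num.min del (b - a) <= b - a by rewrite ge_min lexx orbT.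
  have m3 : 0 < Num.min del (b - a) by rewrite lt_min del0; lra.
  by split; [lra|lra|rewrite ltr_norml; lra].
by exists (ev t d); [apply: h; rewrite t1 t2|exact: near_q].
Qed.

Lemma closure_between d a b x : 1 < a -> a <= b ->
  (forall q, a <= q <= b -> C (ev q d)) -> ev b d <= x <= ev a d -> C x.
Proof.
move=> a1 ab h xv.
have [|q qab <-] := @ivt_decreasing R (fun t => ev t d) a b x ab _ xv.
  by move=> t tab; apply: ev_continuous; lra.
exact: h.
Qed.

(** On the lower interval the sequence is itself of level [n]; on the upper one it is a limit of
    sequences of level [n.+1]. *)
Lemma closure_two_levels n q : root n <= q <= root n.+2 ->
  C (ev q (thue_morse n.+1)).
Proof.
have [r1 _ _] := @level_rootP R n; have [r2 _ _] := @level_rootP R n.+1.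
have l1 := @level_root_lt R n; have l2 := @level_root_lt R n.+1.
have [qr|qr] := leP q (root n.+1) => qi.
  apply: (closure_sweep _ (root n) (root n.+1)) => //; try lra.
  move=> t tn; apply: subset_closure; apply: (Xiso_level n) => //.
  exact: level_thue_morse.
apply: (closure_sweep _ (root n.+1) (root n.+2)) => //; try lra.
by move=> t tn; exact: closure_level_limit.
Qed.

Definition level_value n : R := ev (root n) (thue_morse n.+1).

Lemma level_valueE n : level_value n =
  1 + (root n ^+ (2 ^ n.+1))^-1 * (vmax 1 (root n) - 1).
Proof.
have [r1 _ r0] := @level_rootP R n; have q1 : 1 < root n by lra.
have := ev_thue_morse n.+1 _ q1; rewrite -/(level_value n) /= tm_prodS expV_double.
have := expV_bounds (root n) (2 ^ n) q1 ltac:(by rewrite expn_gt0).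
have := inv_lt1 _ q1; move: r0; rewrite /level_gap.
set s := (_ ^+ _)^-1; set c := vmax 1 _ => r0 i1 s1.
have -> : tm_prod n (root n) = (c - 1) * (1 + s) by lra.
have -> : (c - 1) * (1 + s) * (1 - s) * (1 - 2 * (s * s)) / (1 - s * s) =
    (c - 1) * (1 - 2 * (s * s)).
  by field; rewrite gt_eqF //; nra.
lra.
Qed.

(** Yields [S <= 100/289] in [level_value_next], small enough for [S <= (1 - S)^2]; the bound 3/2 is
    too weak for this. *)
Lemma level_root_gt n : 17/10 < root n.+1.
Proof.
rewrite -level_gap_lt0; last lra.
rewrite /level_gap tm_prod_sqr vmax1.
have := tm_prod_bounds n ((17/10) ^+ 2 : R) ltac:(lra).
have := expV_bounds (17/10 : R) (2 ^ n.+1) ltac:(lra) ltac:(by rewrite expn_gt0).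
have -> : (17/10)^-1 = 10/17 :> R by field.
have -> : 1 / (17/10 - 1) - 1 = 3/7 :> R by field.
lra.
Qed.

(** Makes consecutive ranges overlap. With [S = q^-(2^(n+1))] and [c = vmax 1 q] at [q = root n.+2],
    the left side is [1 + (c - 1) S^3 / (1 - S)^2], at most [1 + (c - 1) S^2], which grows on
    passing to the smaller base [root n.+1]. *)
Lemma level_value_next n :
  ev (root n.+2) (thue_morse n.+1) <= level_value n.+1.
Proof.
rewrite level_valueE.
have r1 := level_root_gt n; have lt12 := @level_root_lt R n.+1.
have [_ r2 r0] := @level_rootP R n.+2.
have q1 : 1 < root n.+1 by lra.
have q2 : 1 < root n.+2 by lra.
have := ev_thue_morse n.+1 _ q2; rewrite /=.
have c12 := vmax1_lt _ _ q1 lt12.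
have := expV_le _ _ (2 ^ n.+1) (lt_trans ltr01 q1) (ltW lt12).
have S0 : 0 < (root n.+2 ^+ (2 ^ n.+1))^-1 <= 100/289.
  rewrite expnS exprM.
  have := expV_bounds (root n.+2 ^+ 2) (2 ^ n) ltac:(nra) ltac:(by rewrite expn_gt0).
  have : (root n.+2 ^+ 2)^-1 <= 100/289.
    have q17 : 17/10 < root n.+2 by lra.
    have q289 : 289/100 < root n.+2 ^+ 2 by rewrite expr2; nra.
    by rewrite -[100/289]invf_div lef_pV2 ?posrE; lra.
  by move=> h /andP[-> /=] /le_trans; apply.
move: r0; rewrite /level_gap tm_prodS !expV_double -!expV_double.
have c1 : 1 < vmax 1 (root n.+2).
  have := vmax1_lt (root n.+2) 2 q2 r2.
  by have -> : vmax 1 2 = 1 :> R by rewrite vmax1; field.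
rewrite [(root n.+2 ^+ (2 ^ n.+2))^-1]expV_double.
rewrite [(root n.+1 ^+ (2 ^ n.+2))^-1]expV_double.
move: S0 c12 c1.
move: (root n.+2 ^+ _)^-1 (root n.+1 ^+ _)^-1 (vmax 1 _) (vmax 1 _) => S S' c' c.
move: (tm_prod _ _) (ev _ _) => t v S0 c12 c1 r0 SS' v2.
have S1 : 1 - S != 0 by rewrite gt_eqF //; lra.
have tE : t = (c - 1) * (1 + S * S) / (1 - S).
  have -> : (c - 1) * (1 + S * S) = t * (1 - S) by lra.
  by field.
have -> : v = 1 + (c - 1) * (S * S) * (S / (1 - S) ^+ 2).
  have -> : v = (c + 1 - t * (1 - 2 * S) / (1 - S)) / 2 by lra.
  by rewrite tE; field.
have k1 : S / (1 - S) ^+ 2 <= 1.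
  by rewrite ler_pdivrMr ?exprn_gt0; nra.
have cS : 0 <= (c - 1) * (S * S) by rewrite !mulr_ge0; lra.
have SS : S * S <= S' * S' by nra.
have : (c - 1) * (S * S) <= S' * S' * (c' - 1) by nra.
nra.
Qed.

Lemma closure_below_level_value n x : (level_value n.+1 <= x <= level_value n) -> C x.
Proof.
move=> /andP[xl xr]; have [r1 _ _] := @level_rootP R n.
have l1 := @level_root_lt R n; have l2 := @level_root_lt R n.+1.
apply: (closure_between (thue_morse n.+1) (root n) (root n.+2)); try lra.
  by move=> q; exact: closure_two_levels.
by apply/andP; split; [exact: le_trans (level_value_next n) xl|exact: xr].
Qed.

(** [level_value n] tends to 1, so the least [n] with [level_value n < x] places [x] between two
    consecutive values. *)
Lemma closure_near1 x : 1 < x <= level_value 0 -> C x.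
Proof.
move=> /andP[x1 x0].
have [n xn] : exists n, level_value n < x.
  have [n _ /(_ n)] := @geometric_lt R (2/3) 1 (x - 1) ltac:(lra) ltac:(lra).
  rewrite /= leqnn mul1r => /(_ isT) nx; exists n; rewrite level_valueE.
  have [r1 r2 _] := @level_rootP R n.
  have c1 : vmax 1 (root n) < 2.
    have := vmax1_lt (3/2 : R) (root n) ltac:(lra) r1.
    by have -> : vmax 1 (3/2) = 2 :> R by rewrite vmax1; field.
  have : (root n ^+ (2 ^ n.+1))^-1 <= (2/3) ^+ n.
    apply: (@le_trans _ _ (((3/2) ^+ (2 ^ n.+1))^-1)); first by apply: expV_le; lra.
    rewrite -exprVn invf_div; apply: ler_wiXn2l; [lra|lra|].
    by apply: ltnW; apply: (leq_trans (ltnSn n)); rewrite ltnW // ltn_expl.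
  have := expV_bounds (root n) (2 ^ n.+1) ltac:(lra) ltac:(by rewrite expn_gt0).
  nra.
case: (ex_minnP (ex_intro (fun n => level_value n < x) n xn)) => -[|m] mx mmin; first lra.
apply: (closure_below_level_value m); rewrite (ltW mx) /= leNgt.
by apply/negP => /mmin; rewrite ltnn.
Qed.

Lemma level_root0_lt : root 0 < 13/8.
Proof.
rewrite -level_gap_gt0; last lra.
rewrite /level_gap /tm_prod big_ord0 vmax1 expn0 expr1 invf_div.
have -> : 1 / (13/8 - 1) = 8/5 :> R by field.
by lra.
Qed.

Lemma level_root1_gt : 7/4 < root 1.
Proof.
rewrite -level_gap_lt0; last lra.
rewrite /level_gap tm_prodS /tm_prod big_ord0 vmax1 expn0 expr1 expn1 invf_div.
have -> : 1 / (7/4 - 1) = 4/3 :> R by field.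
have -> : ((7/4) ^+ 2)^-1 = 16/49 :> R by field.
by lra.
Qed.

Lemma level_value0_ge : 6/5 <= level_value 0.
Proof.
rewrite level_valueE; have [r1 _ _] := @level_rootP R 0; have r2 := level_root0_lt.
have := vmax1_lt (root 0) (13/8) ltac:(lra) r2; 
have -> : vmax 1 (13/8) = 8/5 :> R by rewrite vmax1; field.
have := expV_le (root 0) (13/8) (2 ^ 1) ltac:(lra) (ltW r2).
have -> : ((13/8) ^+ (2 ^ 1))^-1 = 64/169 :> R by rewrite expn1; field.
nra.
Qed.

(** [x] is the value of [1^oo] in base [1 + 1 / x], which for [x >= 4/3] is at most 7/4, hence below
    [root 1]. *)
Lemma closure_large x : 4/3 <= x -> C x.
Proof.
move=> x43; have x0 : 0 < x by lra.
have xV : x^-1 <= 3/4 by rewrite -[3/4]invf_div lef_pV2 ?posrE; lra.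
have xV0 : 0 < x^-1 by rewrite invr_gt0.
have <- : ev (1 + x^-1) (thue_morse 0) = x.
  rewrite ev_ord_max; last lra.
  by rewrite vmax1 addrC addKr mul1r invrK.
have r1 := level_root1_gt; have r01 := @level_root_lt R 0.
have [r0 _ _] := @level_rootP R 0.
have [qr|qr] := ltP (1 + x^-1) (root 0).
  by apply: subset_closure; apply: Xiso_constant; lra.
apply: (closure_sweep _ (root 0) (root 1)); try lra.
by move=> q; exact: closure_level_limit.
Qed.

Lemma ev_ramp2 q : 1 < q ->
  ev q (ramp 2) = q^-1 + (q ^+ 2)^-1 + 1 / (q * (q ^+ 2 - 1)).
Proof.
move=> q1; have q0 : q != 0 by rewrite gt_eqF //; lra.
have q20 : q ^+ 2 - 1 != 0 by rewrite gt_eqF //; nra.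
have per : dshift 2 (ramp 0) = ramp 0.
  by apply/funext => i; rewrite /dshift /ramp !subn0 /= negbK.
have r0 : ev q (ramp 0) = q / (q ^+ 2 - 1).
  have : (q ^+ 2 - 1) * ev q (ramp 0) = q.
    have := evD q (ramp 0) 2 q1; rewrite per !psumS psum0 /= => h.
    by rewrite mulrBl {1}h mul1r; field.
  by move=> h; apply: (mulfI q20); rewrite h mulrCA divff // mulr1.
have per2 : dshift 2 (ramp 2) = ramp 0.
  by apply/funext => i; rewrite /dshift /ramp addKn subn0.
rewrite (evD q _ 2 q1) per2 r0 !psumS psum0 /=.
by field; rewrite q0 q20.
Qed.

(** The bases from 13/8 to 7/4 lie between [root 0] and [root 1], and the values of [ramp 2] there
    run from above 4/3 to below 6/5. *)
Lemma closure_middle x : 6/5 <= x <= 4/3 -> C x.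
Proof.
move=> x1; have r0 := level_root0_lt; have r1 := level_root1_gt.
apply: (closure_between (ramp 2) (13/8) (7/4)); try lra.
  move=> q q1; apply: subset_closure; apply: (Xiso_level 0); first lra.
  exact: level_ramp.
rewrite !ev_ramp2; [|lra|lra].
have -> : (7/4)^-1 + ((7/4) ^+ 2)^-1 + 1 / (7/4 * ((7/4) ^+ 2 - 1)) =
  4/7 + 16/49 + 64/231 :> R by field.
have -> : (13/8)^-1 + ((13/8) ^+ 2)^-1 + 1 / (13/8 * ((13/8) ^+ 2 - 1)) =
  8/13 + 64/169 + 512/1365 :> R by field.
lra.
Qed.

Lemma closure_gt1 x : 1 < x -> C x.
Proof.
move=> x1; have v := level_value0_ge.
have [a|a] := leP x (6/5); first by apply: closure_near1; lra.
have [b|b] := leP x (4/3); first by apply: closure_middle; lra.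
by apply: closure_large; lra.
Qed.

End Covering.

Theorem theorem1p7 (R : realType) (M : nat) (hM : (1 <= M)%N) :
  `[0, 1] `<=` closure (Xiso R M) /\
  (M = 1%N -> `]0, +oo[ `<=` closure (Xiso R M)).
Proof.
have unit_interval x : 0 <= x <= 1 -> closure (Xiso R M) x.
  by move=> x01; apply: closure_approx => eps; exact: Xiso_near_unit_interval.
split=> [x|M1 x]; rewrite /= in_itv /=; first exact: unit_interval.
rewrite andbT => x0; have [x1|x1] := leP x 1; first by apply: unit_interval; lra.
by subst M; exact: closure_gt1.
Qed.
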